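(* Let $T\subset(0,+\infty)$ be a measurable set, let $F$ be a probability distribution on $T$, and let $G$ be a probability distribution on $(0,+\infty)$. Let $\nu$ be a random variable with distribution $G$ such that $\mathbf{E}\ln\nu$ exists and is finite, and put $\delta=\gamma+\mathbf{E}\ln\nu$, where $\gamma=0.577\ldots$ is the Euler constant. If $$\limsup_{x\to+\infty} x(-\ln F(x))<e^{-\delta}\qquad\text{and}\qquad \liminf_{x\to 0+} x(-\ln F(x))>e^{-\delta},$$ then the maximal branching process in power-law random environment on $T$ (the process $\mathrm{MBPPLRE}(T)$) determined by $F$ and $G$ is ergodic.
   Context: A distribution $F$ on a measurable set $T\subset\mathbb{R}_+=[0,+\infty)$ is identified with its distribution function $F(x)$, $x\in\mathbb{R}$. Convention: $-\ln 0=+\infty$. Let $\varphi(u)=\mathbf{E}e^{-u\nu}$, $u\ge 0$, be the Laplace--Stieltjes transform of $G$, where $\nu$ has distribution $G$ on $(0,+\infty)$; put $\varphi(+\infty)=0$. The process $\mathrm{MBPPLRE}(T)$ (maximal branching process in ''power-law'' random environment) determined by $F$ and $G$ is the time-homogeneous Markov chain $\{Z_n\}_{n\ge 0}$ with values in $T$ and transition probabilities $$\mathbf{P}(Z_{n+1}\le y\mid Z_n=x)=\mathbf{E}\big(F(y)^{x\nu}\big)=\varphi(-x\ln F(y)),\qquad x,y\in T.$$ ''Ergodic'' means Harris ergodic: the chain has a unique invariant probability distribution on $T$ and, for every initial state in $T$, the distribution of $Z_n$ converges to it in total variation as $n\to\infty$. *)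

(* Defs.v *)
From HB Require Import structures.
From mathcomp Require Import all_boot all_order all_algebra.
From mathcomp Require Import all_classical all_reals all_analysis.

Set Implicit Arguments.
Unset Strict Implicit.
Unset Printing Implicit Defensive.

Import Order.TTheory GRing.Theory Num.Theory.
Import numFieldTopology.Exports numFieldNormedType.Exports.

Local Open Scope classical_set_scope.
Local Open Scope ring_scope.

Definition euler_gamma (R : realType) : R :=
  lim ((\sum_(1 <= k < n.+1) (k%:R)^-1 - ln (n%:R : R)) @[n --> \oo]).

Definition distr_fun (R : realType)
    (F : probability (measurableTypeR R) R) (x : R) : R :=
  fine (F `]-oo, x]%classic).

(* [lne] is the extended logarithm, with [lne 0 = -oo], so [neg_log 0 = +oo]. *)
Definition neg_log (R : realType) (p : R) : \bar R := (- lne p%:E)%E.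

(* A Markov chain on a measurable set [T] of reals is encoded by a probability
   kernel [K] on the whole line with [K x T = 1] for [x] in [T]. The values of
   [K x] for [x] outside [T] are irrelevant: as [T] is measurable, every kernel
   on [T] extends to such a [K]. *)

(* [K] is the transition kernel of MBPPLRE(T) determined by F and G. Since
   [0 `^ r = 0] for [r != 0], and [x * v > 0] for [x] in [T] and G-almost every
   [v], the integrand has its usual meaning also when F(y) = 0. The half-lines
   with end point [y] in [T] generate the Borel subsets of [T], so this
   determines [K x] for [x] in [T]. *)
Definition MBPPLRE_kernel (R : realType) (T : set R)
    (F G : probability (measurableTypeR R) R)
    (K : R.-pker (measurableTypeR R) ~> (measurableTypeR R)) : Prop :=
  forall x : R, T x ->
    K x T = 1%E /\
    forall y : R, T y ->
      K x `]-oo, y]%classic = (\int[G]_v ((distr_fun F y) `^ (x * v))%:E)%E.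

(* [step_distr K n x] is the distribution of the chain at time [n] when it
   starts from [x] at time [0]. *)
Fixpoint step_distr (R : realType)
    (K : R.-pker (measurableTypeR R) ~> (measurableTypeR R))
    (n : nat) (x : R) (A : set R) : \bar R :=
  if n is m.+1 then (\int[K x]_y step_distr K m y A)%E else (\d_x A)%E.

Definition tv_dist (R : realType) (mu1 mu2 : set R -> \bar R) : \bar R :=
  ereal_sup [set `| mu1 A - mu2 A |%E
            | A in [set A : set (measurableTypeR R) | measurable A]].

Definition invariant_distr (R : realType) (T : set R)
    (K : R.-pker (measurableTypeR R) ~> (measurableTypeR R))
    (p : probability (measurableTypeR R) R) : Prop :=
  p T = 1%E /\
  forall A : set (measurableTypeR R), measurable A ->
    (\int[p]_(x in T) K x A)%E = p A.

Definition ergodic_on (R : realType) (T : set R)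
    (K : R.-pker (measurableTypeR R) ~> (measurableTypeR R)) : Prop :=
  exists p : probability (measurableTypeR R) R,
    [/\ invariant_distr T K p,
        forall q : probability (measurableTypeR R) R, invariant_distr T K q ->
          forall A : set (measurableTypeR R), measurable A -> q A = p A
      & forall x : R, T x ->
          tv_dist (step_distr K n x) p @[n --> \oo] --> 0%E].

(* Main.v *)
(** Let [U] be uniform on (0, 1) and independent of [nu]. Up to the atoms of F, the
    chain moves from x to the point z with [F z = U^(1 / (x nu))], that is,
    [- ln (- ln (F z)) = ln x + ln nu + g] with [g = - ln (- ln U)]. Here g has a
    Gumbel distribution, whose mean is the Euler constant: g differs by at most
    [- ln U / m] from the maximum of m standard exponential variables minus [ln m],
    whose mean is [1 + 1/2 + ... + 1/m - ln m]. Hence the hypotheses on F say that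
    [|ln Z_n|] decreases by a fixed amount in the mean when it is large.

    As only the first moment of [ln nu] is finite, this drift is additive. Let
    [V x = h (ln x - a) + h (- ln x - a)], where h is convex and its slope grows from
    0 to 1 so slowly that PV <= V + eps everywhere; still PV <= V - 2 eps outside a
    compact set C, so that V(x) + V(y) decreases in the mean by eps unless x and y
    both lie in C. On C the kernels have a common minorant kappa, because
    [u^x - (x / b) u^b] is nondecreasing in u on [0, 1] for x <= b. With W = V + M
    and M large, induction on n gives [n eps |P^n(x, A) - P^n(y, A)| <= W x + W y].
    The invariant distribution is, up to normalization, [sum_n kappa R^n] for the
    residual kernel R = P - 1_C kappa; it is finite because [RW <= W - eps]. *)

Require Import Defs.
From HB Require Import structures.
From mathcomp Require Import all_boot all_order all_algebra.
From mathcomp Require Import all_classical all_reals all_analysis.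
From mathcomp Require Import measurable_realfun giry ring lra.

Import Order.TTheory GRing.Theory Num.Theory.
Import numFieldTopology.Exports numFieldNormedType.Exports.

Set Implicit Arguments.
Unset Strict Implicit.
Unset Printing Implicit Defensive.

Local Open Scope classical_set_scope.
Local Open Scope ring_scope.

(** The model behind the hypotheses is [F y = exp (- q / y)], a Frechet law: for it [ln Z_n] is
    exactly a random walk with steps [ln q + ln nu + g], of mean [ln q + delta]. A general F is
    compared with two such laws, with [q = exp (- delta - e)] near infinity and
    [q = exp (- delta + e)] near 0, separately for the tails of [ln Z] and of [- ln Z]. Only tails
    are compared, so no coupling is constructed.

    Two obstacles shape the details. The transition law is prescribed only for thresholds in T, an
    arbitrary measurable set, while the tail comparison and the minorization need every real
    threshold; the formula must first be extended across the gaps of T. Moreover an additive drift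
    does not make W integrable for the invariant law. The bound on [|P^n(x, A) - P^n(y, A)|]
    therefore cannot simply be integrated in y: it is truncated at 1 and dominated convergence is
    applied, which gives convergence in total variation without a rate. *)

(** * Integration against measures carried by a measurable set *)

Lemma null_ae_in {d} {X : measurableType d} {R : realType}
    (mu : {measure set X -> \bar R}) (T : set X) (P : X -> Prop) :
  measurable T -> mu (~` T) = 0%E -> (forall x, T x -> P x) ->
  {ae mu, forall x, [set: X] x -> P x}.
Proof.
move=> mT muT TP; exists (~` T); split => //; first exact: measurableC.
by move=> x /= nP Tx; apply: nP => _; exact: TP.
Qed.

Lemma null_le_integral {d} {X : measurableType d} {R : realType}
    (mu : {measure set X -> \bar R}) (T : set X) (f g : X -> \bar R) :
  measurable T -> mu (~` T) = 0%E ->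
  (forall x, 0 <= f x)%E -> measurable_fun setT f ->
  (forall x, 0 <= g x)%E -> measurable_fun setT g ->
  (forall x, T x -> f x <= g x)%E ->
  (\int[mu]_x f x <= \int[mu]_x g x)%E.
Proof.
move=> mT muT f0 mf g0 mg fg.
apply: ae_ge0_le_integral => //.
exact: (null_ae_in mT muT).
Qed.

Lemma integral_null_compl {d} {X : measurableType d} {R : realType}
    (mu : {measure set X -> \bar R}) (T : set X) (f : X -> \bar R) :
  measurable T -> mu (~` T) = 0%E -> (forall x, 0 <= f x)%E ->
  measurable_fun setT f -> (\int[mu]_(x in T) f x = \int[mu]_x f x)%E.
Proof.
move=> mT muT f0 mf.
rewrite (ge0_negligible_integral (measurableC mT) measurableT mf _ muT)//.
by rewrite setDE setTI setCK.
Qed.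

Lemma probability_null_compl {d} {X : measurableType d} {R : realType}
    (p : probability X R) (T : set X) :
  measurable T -> (p (~` T) = 0%E <-> p T = 1%E).
Proof.
move=> mT; split => pT; last by rewrite probability_setC// pT subee.
by rewrite -(setCK T) probability_setC ?pT ?sube0//; exact: measurableC.
Qed.

Lemma le_measure_null_compl {d} {X : measurableType d} {R : realType}
    (mu : {measure set X -> \bar R}) (T A B : set X) :
  measurable T -> measurable A -> measurable B -> mu (~` T) = 0%E ->
  A `&` T `<=` B -> (mu A <= mu B)%E.
Proof.
move=> mT mA mB muT ATB; have mTC := measurableC mT.
have -> : (mu B = mu B + mu (~` T))%E by rewrite muT adde0.
apply: le_trans (measureU2 _ mB mTC); rewrite le_measure ?inE//.
  exact: measurableU.
move=> x Ax; have [Tx|nTx] := pselect (T x); [left|by right].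
exact: ATB.
Qed.

(* A constant [c] lying between [g - a] and [g + a] replaces a coupling of the
   two measures. *)
Lemma integral_le_of_oscillation {d} {X : measurableType d} {R : realType}
    (m1 m2 : {measure set X -> \bar R}) (T : set X) (g a : X -> R) :
  measurable T -> T !=set0 ->
  m1 (~` T) = 0%E -> m2 (~` T) = 0%E -> m1 setT = m2 setT ->
  (forall x, 0 <= g x) -> measurable_fun setT g ->
  (forall x, 0 <= a x) -> measurable_fun setT a ->
  (forall x y, T x -> T y -> g x <= g y + (a x + a y)) ->
  (\int[m1]_x (g x)%:E <=
   \int[m2]_x (g x)%:E + (\int[m1]_x (a x)%:E + \int[m2]_x (a x)%:E))%E.
Proof.
move=> mT [x0 Tx0] m1T m2T m12 g0 mg a0 ma gaT.
pose S := [set g y + a y | y in T].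
have S0 : S !=set0 by exists (g x0 + a x0), x0.
have lbS : has_lbound S.
  by exists 0 => _ [y _ <-]; rewrite addr_ge0.
pose c := inf S.
have c0 : 0 <= c by apply: lb_le_inf => // _ [y _ <-]; rewrite addr_ge0.
have gc x : T x -> g x <= a x + c.
  move=> Tx; rewrite -lerBlDl; apply: lb_le_inf => // _ [y Ty <-].
  by have := gaT _ _ Tx Ty; lra.
have cg x : T x -> c <= g x + a x by move=> Tx; apply: ge_inf => //; exists x.
have mE (f : X -> R) : measurable_fun setT f ->
    measurable_fun setT (fun x => (f x)%:E) by move=> mf; exact/measurable_EFinP.
apply: (@le_trans _ _ (\int[m1]_x (a x)%:E + c%:E * m1 setT)%E).
  rewrite -(@integral_cst _ _ _ m1 setT) // -ge0_integralD //;
    try by [move=> x _; rewrite lee_fin | exact: mE].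
  apply: (@null_le_integral _ _ _ _ T) => //; try exact: mE.
  - by move=> x; rewrite -EFinD lee_fin addr_ge0.
  - by apply: emeasurable_funD => //; exact: mE.
rewrite [leRHS]addeCA; apply: leeD => //.
(* Equality of the total masses lets the constant [c] pass from [m1] to [m2]. *)
rewrite m12 -(@integral_cst _ _ _ m2 setT) // -ge0_integralD //;
  try by [move=> x _; rewrite lee_fin | exact: mE].
apply: (@null_le_integral _ _ _ _ T) => //; try exact: mE.
- by move=> x; rewrite -EFinD lee_fin addr_ge0.
- by apply: emeasurable_funD => //; exact: mE.
Qed.

(** * Drift and minorization imply ergodicity *)

Section subprobability_of.
Context d (X : measurableType d) (R : realType).
Context (mu : {measure set X -> \bar R}).
Hypothesis mu_le1 : (mu setT <= 1)%E.

(* The bound on the mass is an argument, so that the instance can refer to it. *)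
Definition subprobability_of : set X -> \bar R := let _ := mu_le1 in mu.

HB.instance Definition _ := Measure.copy subprobability_of mu.

HB.instance Definition _ :=
  Measure_isSubProbability.Build _ _ _ subprobability_of mu_le1.

End subprobability_of.

Section probability_of.
Context d (X : measurableType d) (R : realType).
Context (mu : {measure set X -> \bar R}).
Hypothesis mu1 : mu setT = 1%E.

Definition probability_of : set X -> \bar R := let _ := mu1 in mu.

HB.instance Definition _ := Measure.copy probability_of mu.

HB.instance Definition _ :=
  Measure_isProbability.Build _ _ _ probability_of mu1.

End probability_of.

(** Counterpart of [step_distr] on an arbitrary measurable space, where the drift argument takes
    place. *)
Fixpoint kernel_iter {d} {X : measurableType d} {R : realType}
    (K : R.-pker X ~> X) (n : nat) (x : X) (A : set X) : \bar R :=
  if n is m.+1 then (\int[K x]_y kernel_iter K m y A)%E else (\d_x A)%E.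

Section kernel_iter.
Context d (X : measurableType d) (R : realType) (K : R.-pker X ~> X).

Lemma kernel_iter_ge0 n x A : (0 <= kernel_iter K n x A)%E.
Proof.
elim: n x => [|n IH] x //=; exact: integral_ge0.
Qed.

Lemma measurable_kernel_iter n A : measurable A ->
  measurable_fun setT (fun x => kernel_iter K n x A).
Proof.
move=> mA; elim: n => [|n IH] /=.
  rewrite /dirac /=; exact/measurable_EFinP/measurable_indic.
apply: measurable_fun_integral_kernel => //.
- by move=> U mU; exact: measurable_kernel.
- by move=> z; exact: kernel_iter_ge0.
Qed.

Lemma kernel_iter_le1 n x A : measurable A -> (kernel_iter K n x A <= 1)%E.
Proof.
move=> mA; elim: n x => [|n IH] x /=; first
  by rewrite /dirac lee_fin indicE; case: (_ \in _).
apply: (@le_trans _ _ (\int[K x]_y (cst 1%E y))%E).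
  apply: ge0_le_integral => //.
  - by move=> y _; exact: kernel_iter_ge0.
  - exact: measurable_kernel_iter.
by rewrite integral_cst // mul1e sprob_kernel_le1.
Qed.

Lemma kernel_iter_fin_num n x A : measurable A ->
  kernel_iter K n x A \is a fin_num.
Proof.
move=> mA; rewrite ge0_fin_numE ?kernel_iter_ge0//.
by rewrite (le_lt_trans (kernel_iter_le1 n x mA))// ltry.
Qed.

Lemma measurable_kernel_giry :
  measurable_fun setT
    (fun x => subprobability_of (sprob_kernel_le1 K x) : giry X R).
Proof.
apply: measurable_giry_codensity => // B mB; exact: measurable_kernel.
Qed.

(** Invariance says that the Giry bind of [q] with [K] agrees with [q] on measurable sets, so both
    integrate [f] alike. *)
Lemma integral_invariant (q : probability X R) (f : X -> \bar R) :
  (forall A, measurable A -> (\int[q]_x K x A = q A)%E) ->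
  (forall x, 0 <= f x)%E -> measurable_fun setT f ->
  (\int[q]_x \int[K x]_y f y = \int[q]_x f x)%E.
Proof.
move=> qK f0 mf.
have := giry_int_bind (q : giry X R) measurable_kernel_giry mf f0.
rewrite /giry_int => <-; apply: eq_measure_integral => A mA _.
set b := giry_bind _ _.
transitivity (\int[b]_x (\1_A x)%:E)%E; first by rewrite integral_indic// setIT.
have mA1 : measurable_fun setT (fun x => (\1_A x)%:E : \bar R).
  exact/measurable_EFinP/measurable_indic.
have A0 x : (0 <= (\1_A x)%:E :> \bar R)%E by rewrite lee_fin.
have := giry_int_bind (q : giry X R) measurable_kernel_giry mA1 A0.
rewrite /giry_int => ->; rewrite -[RHS](qK A mA).
by apply: eq_integral => x _; rewrite integral_indic// setIT.
Qed.

Lemma integral_invariant_iter (q : probability X R) n A :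
  (forall A, measurable A -> (\int[q]_x K x A = q A)%E) -> measurable A ->
  (\int[q]_x kernel_iter K n x A = q A)%E.
Proof.
move=> qK mA; elim: n => [|n IH] /=.
  by rewrite /dirac integral_indic// setIT.
rewrite integral_invariant//; last exact: measurable_kernel_iter.
by move=> x; exact: kernel_iter_ge0.
Qed.

End kernel_iter.

Section harris.
Context d (X : measurableType d) (R : realType) (K : R.-pker X ~> X).
Context (T C : set X) (kappa : giry X R) (V : X -> R) (eps : R).
Hypotheses (mT : measurable T) (mC : measurable C) (CT : C `<=` T).
Hypotheses (C0 : C !=set0) (KT : forall x, T x -> K x T = 1%E).
Hypothesis kappa_gt0 : (0 < kappa setT)%E.
Hypothesis minorized : forall x, C x ->
  exists lam : {measure set X -> \bar R},
    forall A, measurable A -> K x A = (kappa A + lam A)%E.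
Hypotheses (V_ge0 : forall x, 0 <= V x) (mV : measurable_fun setT V).
Hypothesis eps_gt0 : 0 < eps.
Hypothesis drift : forall x, T x -> (\int[K x]_y (V y)%:E <= (V x + eps)%:E)%E.
Hypothesis drift_out : forall x, T x -> ~ C x ->
  (\int[K x]_y (V y)%:E <= (V x - 2 * eps)%:E)%E.

Lemma exists_residual x : exists rho : giry X R, forall A, measurable A ->
  (C x -> K x A = (kappa A + rho A)%E) /\ (~ C x -> rho A = K x A).
Proof.
have [Cx|nCx] := pselect (C x); last first.
  by exists (subprobability_of (sprob_kernel_le1 K x)).
have [lam lamE] := minorized Cx.
have lam1 : (lam setT <= 1)%E.
  rewrite (le_trans _ (sprob_kernel_le1 K x))// (lamE _ measurableT).
  by rewrite leeDr.
by exists (subprobability_of lam1) => A mA; split => // _; rewrite lamE.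
Qed.

Definition residual x : giry X R := projT1 (cid (exists_residual x)).

Lemma residual_in x A : measurable A -> C x ->
  K x A = (kappa A + residual x A)%E.
Proof. by move=> mA; apply: (projT2 (cid (exists_residual x)) A mA).1. Qed.

Lemma residual_out x A : measurable A -> ~ C x -> residual x A = K x A.
Proof. by move=> mA; apply: (projT2 (cid (exists_residual x)) A mA).2. Qed.

Lemma residualE x A : measurable A ->
  K x A = (residual x A + kappa A * (\1_C x)%:E)%E.
Proof.
move=> mA; rewrite indicE; have [Cx|nCx] := pselect (C x).
  by rewrite mem_set// mule1 addeC; exact: residual_in.
by rewrite memNset// mule0 adde0 residual_out.
Qed.

(** [residual] is chosen point by point, but its value on a set [B] is forced to be
    [K x B - kappa B * 1_C x], a difference of finite measurable functions. *)
Lemma measurable_residual : measurable_fun setT residual.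
Proof.
apply: measurable_giry_codensity => // B mB.
have kB : kappa B \is a fin_num by rewrite fin_num_measure.
rewrite (_ : residual ^~ B = (fun x => K x B - kappa B * (\1_C x)%:E)%E).
  apply: emeasurable_funB; first exact: measurable_kernel.
  apply: measurable_funeM; exact/measurable_EFinP/measurable_indic.
apply/funext => x; rewrite residualE// addeK//.
by rewrite fin_numM.
Qed.

Lemma null_outside x : T x -> K x (~` T) = 0%E.
Proof.
move=> Tx.
have KU : (K x setT = K x T + K x (~` T))%E.
  by rewrite -(setUv T) measureU ?setICr//; exact: measurableC.
move: KU; rewrite (prob_kernel x) KT// => E1.
have := congr1 (fun z => z - 1)%E E1.
by rewrite subee// addeAC subee// add0e => <-.
Qed.

Lemma kappa_null : kappa (~` T) = 0%E.
Proof.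
have [x0 Cx0] := C0.
apply/eqP; rewrite eq_le measure_ge0 andbT -(null_outside (CT Cx0)).
by rewrite (residual_in (measurableC mT) Cx0) leeDl.
Qed.

Lemma residual_null x : T x -> residual x (~` T) = 0%E.
Proof.
move=> Tx; apply/eqP; rewrite eq_le measure_ge0 andbT -(null_outside Tx).
by rewrite (residualE x (measurableC mT)) leeDl// mule_ge0// lee_fin.
Qed.

Let alpha := fine (kappa setT).

Let kappa_setT : kappa setT = alpha%:E.
Proof. by rewrite fineK// fin_num_measure. Qed.

Let alpha_gt0 : 0 < alpha.
Proof. by rewrite -lte_fin -kappa_setT. Qed.

(** From a point of [C] the residual kernel has mass [1 - alpha], so the constant [M] loses
    [M * alpha = 2 * eps] in the mean; this turns the drift bound [+ eps] into [- eps]. *)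
Let M := 2 * eps / alpha.

Let W x := V x + M.

Let M_gt0 : 0 < M.
Proof. by rewrite divr_gt0 ?alpha_gt0// mulr_gt0. Qed.

Let W_ge0 x : 0 <= W x.
Proof. by rewrite addr_ge0// ltW// M_gt0. Qed.

Let measurable_W : measurable_fun setT W.
Proof. by apply: measurable_funD. Qed.

Let integral_W (mu : {measure set X -> \bar R}) :
  (\int[mu]_x (W x)%:E = \int[mu]_x (V x)%:E + M%:E * mu setT)%E.
Proof.
rewrite -integral_cst// -ge0_integralD//.
- by move=> x _; rewrite lee_fin.
- exact/measurable_EFinP.
- by move=> x _; rewrite lee_fin ltW// M_gt0.
Qed.

Lemma integral_minorized x (f : X -> \bar R) : C x ->
  (forall y, 0 <= f y)%E -> measurable_fun setT f ->
  (\int[K x]_y f y = \int[kappa]_y f y + \int[residual x]_y f y)%E.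
Proof.
move=> Cx f0 mf; rewrite -ge0_integral_measure_add//.
apply: eq_measure_integral => A mA _.
by rewrite (residual_in mA Cx); exact/esym/measure_addE.
Qed.

Lemma residual_out_integral x (f : X -> \bar R) : ~ C x ->
  (\int[residual x]_y f y = \int[K x]_y f y)%E.
Proof.
by move=> nCx; apply: eq_measure_integral => A mA _; exact: residual_out.
Qed.

Let drift_W_in x : C x ->
  (\int[residual x]_y (W y)%:E <= (W x - eps)%:E)%E.
Proof.
move=> Cx; rewrite integral_W.
have r1 : residual x setT = (1 - alpha)%:E.
  have := residual_in measurableT Cx; rewrite prob_kernel kappa_setT => E1.
  by rewrite EFinB E1 addeAC subee// add0e.
have rV : (\int[residual x]_y (V y)%:E <= (V x + eps)%:E)%E.
  apply: le_trans (drift (CT Cx)).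
  have mEV : measurable_fun setT (fun y => (V y)%:E) by exact/measurable_EFinP.
  rewrite (integral_minorized Cx _ mEV) => [|y]; last by rewrite lee_fin.
  by rewrite leeDr//; apply: integral_ge0 => y _; rewrite lee_fin.
rewrite [X in (M%:E * X)%E]r1 -EFinM; apply: (le_trans (leeD rV (lexx _))).
rewrite -EFinD lee_fin /W.
have -> : M * (1 - alpha) = M - 2 * eps.
  by rewrite /M; field; rewrite gt_eqF// alpha_gt0.
by lra.
Qed.

Let drift_W_out x : T x -> ~ C x ->
  (\int[K x]_y (W y)%:E <= (W x - 2 * eps)%:E)%E.
Proof.
move=> Tx nCx; rewrite integral_W [X in (M%:E * X)%E](prob_kernel x) mule1.
apply: (le_trans (leeD (drift_out Tx nCx) (lexx _))).
by rewrite -EFinD lee_fin /W; lra.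
Qed.

Let drift_W x : T x -> (\int[K x]_y (W y)%:E <= (W x + eps)%:E)%E.
Proof.
move=> Tx; rewrite integral_W [X in (M%:E * X)%E](prob_kernel x) mule1.
apply: (le_trans (leeD (drift Tx) (lexx _))).
by rewrite -EFinD lee_fin /W; lra.
Qed.

Let drift_residual x : T x ->
  (\int[residual x]_y (W y)%:E <= (W x - eps)%:E)%E.
Proof.
move=> Tx; have [Cx|nCx] := pselect (C x); first exact: drift_W_in.
rewrite residual_out_integral//; apply: (le_trans (drift_W_out Tx nCx)).
by rewrite lee_fin lerD2l lerN2 ler_pMl// ler1n.
Qed.

Let residual_setT x : C x -> residual x setT = (1 - alpha)%:E.
Proof.
move=> Cx.
have := residual_in measurableT Cx; rewrite prob_kernel kappa_setT => E1.
by rewrite EFinB E1 addeAC subee// add0e.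
Qed.

(** If both points lie in [C], the common part [kappa] cancels and each residual lowers the mean of
    [W] by [eps]. Otherwise some point lies outside [C] and loses [2 * eps], while the other gains
    at most [eps]. *)
Let integral_le_of_oscillation_step (x y : X) (g : X -> R) : T x -> T y ->
  (forall z, 0 <= g z) -> measurable_fun setT g ->
  (forall z t, T z -> T t -> g z <= g t + (W z + W t)) ->
  (\int[K x]_z (g z)%:E <= \int[K y]_z (g z)%:E + (W x + W y - eps)%:E)%E.
Proof.
move=> Tx Ty g0 mg gW.
have T0 : T !=set0 by exists x.
have mEg : measurable_fun setT (fun z => (g z)%:E) by exact/measurable_EFinP.
have g0E z : (0 <= (g z)%:E)%E by rewrite lee_fin.
have [[Cx Cy]|nC] := pselect (C x /\ C y).
  rewrite (integral_minorized Cx g0E mEg) (integral_minorized Cy g0E mEg).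
  rewrite -addeA leeD2l//.
  have rT : residual x setT = residual y setT by rewrite !residual_setT.
  apply: (le_trans (integral_le_of_oscillation mT T0 (residual_null Tx)
    (residual_null Ty) rT g0 mg W_ge0 measurable_W gW)).
  apply: leeD2l; apply: (le_trans (leeD (drift_W_in Cx) (drift_W_in Cy))).
  by rewrite -EFinD lee_fin; move: eps_gt0; lra.
have KT' : K x setT = K y setT by rewrite (prob_kernel x) (prob_kernel y).
apply: (le_trans (integral_le_of_oscillation mT T0 (null_outside Tx)
    (null_outside Ty) KT' g0 mg W_ge0 measurable_W gW)).
apply: leeD2l; have [Cx|nCx] := pselect (C x).
  have nCy : ~ C y by move=> Cy; apply: nC.
  apply: (le_trans (leeD (drift_W Tx) (drift_W_out Ty nCy))).
  by rewrite -EFinD lee_fin; lra.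
apply: (le_trans (leeD (drift_W_out Tx nCx) (drift_W Ty))).
by rewrite -EFinD lee_fin; lra.
Qed.

(** By induction [n eps P^n(., A)] has oscillation at most [W x + W y], and one more step improves
    this bound by [eps]. That gain pays for replacing n by n + 1, since two probabilities differ by
    at most 1. *)
Let kernel_iter_contraction n x y A : T x -> T y -> measurable A ->
  (n%:R * eps) * fine (kernel_iter K n x A) <=
  (n%:R * eps) * fine (kernel_iter K n y A) + (W x + W y).
Proof.
move=> Tx Ty mA; elim: n x y Tx Ty => [|n IH] x y Tx Ty.
  by rewrite !mul0r add0r addr_ge0// W_ge0.
pose g z := (n%:R * eps) * fine (kernel_iter K n z A).
have ne0 : 0 <= n%:R * eps by rewrite mulr_ge0// ltW.
have g0 z : 0 <= g z by rewrite mulr_ge0// fine_ge0// kernel_iter_ge0.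
have mfi : measurable_fun setT (fun z => fine (kernel_iter K n z A)).
  by apply: measurableT_comp => //; exact: measurable_kernel_iter.
have mg : measurable_fun setT g by exact: measurable_funM.
have iE z : (\int[K z]_t (g t)%:E =
    ((n%:R * eps) * fine (kernel_iter K n.+1 z A))%:E)%E.
  rewrite EFinM fineK ?kernel_iter_fin_num//=.
  rewrite -ge0_integralZl//; [|exact: measurable_kernel_iter|].
    by apply: eq_integral => t _; rewrite /g EFinM fineK ?kernel_iter_fin_num.
  by move=> t _; exact: kernel_iter_ge0.
have := integral_le_of_oscillation_step Tx Ty g0 mg IH.
rewrite !iE -EFinD lee_fin.
have Gx1 : fine (kernel_iter K n.+1 x A) <= 1.
  by rewrite -lee_fin fineK ?kernel_iter_fin_num// kernel_iter_le1.
have Gy0 : 0 <= fine (kernel_iter K n.+1 y A).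
  by rewrite fine_ge0// kernel_iter_ge0.
move: Gx1 Gy0.
set a := fine _; set b := fine _ => a1 b0 H.
(* [n eps (a - b) <= W x + W y - eps] and [a - b <= 1] *)
have : eps * (a - b) <= eps by rewrite ger_pMr//; lra.
rewrite -natr1; lra.
Qed.

(* [excursion n] is [kappa R^n], the law at time n of the chain started from [kappa]
   and killed whenever the transition from a point of C is drawn from [kappa]. *)
Fixpoint excursion n : giry X R :=
  if n is m.+1 then giry_bind (excursion m) measurable_residual else kappa.

Lemma integral_excursionS n (f : X -> \bar R) :
  measurable_fun setT f -> (forall x, 0 <= f x)%E ->
  (\int[excursion n.+1]_x f x = \int[excursion n]_x \int[residual x]_y f y)%E.
Proof. by move=> mf f0; exact: giry_int_bind. Qed.

Let excursionS n A : measurable A ->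
  excursion n.+1 A = (\int[excursion n]_x residual x A)%E.
Proof.
move=> mA; transitivity (\int[excursion n.+1]_x (\1_A x)%:E)%E.
  by rewrite integral_indic// setIT.
rewrite integral_excursionS.
- by apply: eq_integral => x _; rewrite integral_indic// setIT.
- exact/measurable_EFinP/measurable_indic.
- by move=> x; rewrite lee_fin.
Qed.

Lemma measurable_residual_set A : measurable A ->
  measurable_fun setT (fun x => residual x A).
Proof.
move=> mA; exact: (measurableT_comp (measurable_giry_ev mA) measurable_residual).
Qed.

Lemma measurable_residual_integral (f : X -> \bar R) :
  measurable_fun setT f -> (forall x, 0 <= f x)%E ->
  measurable_fun setT (fun x => \int[residual x]_y f y)%E.
Proof.
move=> mf f0.
exact: (measurableT_comp (measurable_giry_int mf f0) measurable_residual).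
Qed.

Lemma excursion_null n : excursion n (~` T) = 0%E.
Proof.
elim: n => [|n IH]; first exact: kappa_null.
have mCT : measurable (~` T) by exact: measurableC.
rewrite excursionS//; apply/eqP; rewrite eq_le; apply/andP; split; last first.
  exact: integral_ge0.
rewrite -[leRHS](integral0 (excursion n) setT).
apply: (null_le_integral mT IH) => //; first exact: measurable_residual_set.
by move=> x Tx; rewrite residual_null.
Qed.

Let mEW : measurable_fun setT (fun x => (W x)%:E).
Proof. exact/measurable_EFinP/measurable_W. Qed.

Let W0E x : (0 <= (W x)%:E)%E.
Proof. by rewrite lee_fin W_ge0. Qed.

(** The decrease is written as a sum on the left because the integrals are not yet known to be
    finite. *)
Let excursion_drift n :
  (\int[excursion n.+1]_x (W x)%:E + eps%:E * excursion n setT <=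
    \int[excursion n]_x (W x)%:E)%E.
Proof.
rewrite integral_excursionS// -integral_cst// -ge0_integralD//.
- apply: (null_le_integral mT (excursion_null n)) => //.
  + by move=> x; rewrite adde_ge0 ?integral_ge0// lee_fin ltW.
  + by apply: emeasurable_funD => //; exact: measurable_residual_integral.
  + move=> x Tx; rewrite -leeBrDr//.
    exact: drift_residual.
- by move=> x _; exact: integral_ge0.
- exact: measurable_residual_integral.
- by move=> x _; rewrite lee_fin ltW.
Qed.

(** Telescoping bounds [eps] times the total mass of the excursions by the integral of [W] against
    [kappa]. *)
Let excursion_sum_drift n :
  (\int[excursion n]_x (W x)%:E + eps%:E * \sum_(0 <= k < n) excursion k setT <=
   \int[kappa]_x (W x)%:E)%E.
Proof.
elim: n => [|n IH]; first by rewrite big_geq// mule0 adde0.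
apply: le_trans IH; rewrite big_nat_recr//= ge0_muleDr ?sume_ge0//.
by rewrite [X in (_ + X <= _)%E]addeC addeA leeD2r// excursion_drift.
Qed.

(** [kappa] lies below [K x0] for a point [x0] of [C], and the drift bound at [x0] is finite. *)
Let kappa_W : (\int[kappa]_x (W x)%:E < +oo)%E.
Proof.
have [x0 Cx0] := C0.
apply: (@le_lt_trans _ _ (W x0 + eps)%:E); last exact: ltry.
apply: le_trans (drift_W (CT Cx0)).
by rewrite (integral_minorized Cx0 W0E mEW) leeDl// integral_ge0.
Qed.

Let occupation : {measure set X -> \bar R} := mseries excursion 0.

Let occupation_series A : occupation A = (\sum_(0 <= n <oo) excursion n A)%E.
Proof. by []. Qed.

Let occupation_lty : (occupation setT < +oo)%E.
Proof.
suff : (eps%:E * occupation setT <= \int[kappa]_x (W x)%:E)%E.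
  move=> /le_lt_trans /(_ kappa_W).
  case: (occupation setT) (measure_ge0 occupation setT) => [r||]//= _;
    first by move=> _; exact: ltry.
  by rewrite gt0_muley ?lte_fin.
rewrite occupation_series -nneseriesZl//; apply: lime_le.
  by apply: is_cvg_nneseries => n _ _; rewrite mule_ge0// lee_fin ltW.
apply: nearW => n /=; rewrite -ge0_sume_distrr//.
by apply: le_trans (excursion_sum_drift n); rewrite leeDr// integral_ge0.
Qed.

Let occupation_fin A : measurable A -> occupation A \is a fin_num.
Proof.
move=> mA; rewrite ge0_fin_numE//.
by apply: le_lt_trans occupation_lty; rewrite le_measure ?inE.
Qed.

Let occupationE A : occupation A = (kappa A + \sum_(n <oo) excursion n.+1 A)%E.
Proof.
rewrite occupation_series nneseries_recl//=; congr (_ + _)%E.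
rewrite -(@nneseries_addn _ (fun n => excursion n A) 1)//.
by apply: eq_eseriesr => n _; rewrite addn1.
Qed.

(** Split [K] into [residual] and [kappa] on [C]: the first part shifts the series by one, the
    second restarts from [kappa] with weight [occupation C]. *)
Let integral_occupation_kernel A : measurable A ->
  (\int[occupation]_x K x A =
    \sum_(n <oo) excursion n.+1 A + kappa A * occupation C)%E.
Proof.
move=> mA.
have kA : kappa A = (fine (kappa A))%:E by rewrite fineK// fin_num_measure.
rewrite ge0_integral_measure_series//; last exact: measurable_kernel.
rewrite occupation_series kA -nneseriesZl// -nneseriesD//; last first.
  by move=> n _ _; rewrite mule_ge0// lee_fin fine_ge0.
apply: eq_eseriesr => n _; rewrite excursionS// -kA.
have -> : (excursion n C = \int[excursion n]_x (\1_C x)%:E)%E.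
  by rewrite integral_indic// setIT.
rewrite kA -ge0_integralZl//.
- rewrite -ge0_integralD//.
  + by apply: eq_integral => x _; rewrite residualE// -kA.
  + exact: measurable_residual_set.
  + by move=> x _; rewrite mule_ge0// ?lee_fin// fine_ge0.
  + apply: measurable_funeM; exact/measurable_EFinP/measurable_indic.
- exact/measurable_EFinP/measurable_indic.
- by rewrite lee_fin fine_ge0.
Qed.

(** Conservation of mass: the whole-space case of the previous identity gives
    [alpha * occupation C = alpha], finiteness allowing cancellation. In other words, almost every
    excursion is eventually killed, so as much mass is killed as was started. *)
Let occupation_C : occupation C = 1%E.
Proof.
have := integral_occupation_kernel measurableT.
have -> : (\int[occupation]_x K x setT = occupation setT)%E.
  rewrite -[RHS]mul1e -integral_cst//; apply: eq_integral => x _.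
  exact: prob_kernel.
have := occupation_fin measurableT; rewrite occupationE.
have := occupation_fin mC; rewrite kappa_setT.
case: (\sum_(n <oo) _)%E => [s||]//; case: (occupation C) => [c||]// _ _.
rewrite -EFinM -!EFinD => -[] E1; congr (_%:E).
by apply: (mulfI (lt0r_neq0 alpha_gt0)); lra.
Qed.

Let occupation_invariant A : measurable A ->
  (\int[occupation]_x K x A = occupation A)%E.
Proof.
by move=> mA; rewrite integral_occupation_kernel// occupation_C mule1 addeC -occupationE.
Qed.

Let c := fine (occupation setT).

Let c_gt0 : 0 < c.
Proof.
rewrite -lte_fin fineK ?occupation_fin//; apply: (lt_le_trans kappa_gt0).
by rewrite occupationE leeDl// nneseries_ge0.
Qed.

(** The Dirac mass is the default of [mnormalize] for a total mass zero or infinite; [c_gt0] and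
    [occupation_fin] exclude that case. *)
Definition invariant_probability : probability X R :=
  mnormalize occupation \d_(projT1 (cid C0)).

Let p := invariant_probability.

Lemma invariant_probabilityE A : p A = (c^-1%:E * occupation A)%E.
Proof.
rewrite /p /invariant_probability /= /mnormalize ifF 1?muleC//.
by rewrite -(fineK (occupation_fin measurableT)) eqe orbF gt_eqF// c_gt0.
Qed.

Lemma invariant_probability_null : p (~` T) = 0%E.
Proof.
rewrite invariant_probabilityE occupation_series eseries0 ?mule0// => n _ _.
exact: excursion_null.
Qed.

Lemma integral_invariant_probability (f : X -> \bar R) :
  (forall x, 0 <= f x)%E -> measurable_fun setT f ->
  (\int[p]_x f x = c^-1%:E * \int[occupation]_x f x)%E.
Proof.
move=> f0 mf.
have c'0 : 0 <= c^-1 by rewrite invr_ge0 ltW// c_gt0.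
rewrite -(@ge0_integral_mscale _ _ _ occupation setT measurableT (NngNum c'0) f)//.
apply: eq_measure_integral => A mA _; exact: invariant_probabilityE.
Qed.

Lemma invariant_probabilityP A : measurable A -> (\int[p]_x K x A = p A)%E.
Proof.
move=> mA; rewrite integral_invariant_probability ?occupation_invariant//.
- by rewrite invariant_probabilityE.
- exact: measurable_kernel.
Qed.

(** The truncation at 1 provides the dominating function, [W] being possibly not integrable for
    [p]. *)
Let err x n y := Num.min 1 ((W x + W y) / (n.+1%:R * eps)).

Let kernel_iter_err n x y A : T x -> T y -> measurable A ->
  fine (kernel_iter K n.+1 x A) <= fine (kernel_iter K n.+1 y A) + err x n y.
Proof.
move=> Tx Ty mA; rewrite -lerBlDl le_min; apply/andP; split.
  rewrite lerBlDl -[leLHS]add0r; apply: lerD.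
    by rewrite fine_ge0// kernel_iter_ge0.
  by rewrite -lee_fin fineK ?kernel_iter_fin_num// kernel_iter_le1.
rewrite ler_pdivlMr ?mulr_gt0//.
by rewrite mulrC mulrBr lerBlDl; exact: kernel_iter_contraction.
Qed.

Let err_ge0 x n y : 0 <= err x n y.
Proof.
rewrite le_min ler01/=; apply: divr_ge0; first by rewrite addr_ge0// W_ge0.
by rewrite mulr_ge0// ltW.
Qed.

Let measurable_err x n : measurable_fun setT (err x n).
Proof.
apply: measurable_minr => //; apply: measurable_funM => //.
by apply: measurable_funD => //; exact: measurable_W.
Qed.

Let err_cvg0 x : (\int[p]_y (err x n y)%:E)%E @[n --> \oo] --> 0%E.
Proof.
have [] := @dominated_convergence _ _ _ p setT measurableT
  (fun n y => (err x n y)%:E) (cst 0%E) (cst 1%E).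
- by move=> n; exact/measurable_EFinP/measurable_err.
- by [].
- apply: aeW => y _; apply: cvg_EFin; first exact: nearW.
  rewrite /=.
  apply: (@squeeze_cvgr _ _ _ _ (cst 0) (fun n => (W x + W y) / eps * harmonic n)).
  + near=> n; rewrite err_ge0/= /err ge_min; apply/orP; right.
    by rewrite invfM mulrCA mulrC.
  + exact: cvg_cst.
  + rewrite -[X in _ --> X](mulr0 ((W x + W y) / eps)); apply: cvgMr.
    exact: cvg_harmonic.
- exact: (finite_measure_integrable_cst _ 1).
- apply: aeW => y n _; rewrite gee0_abs ?lee_fin ?err_ge0//.
  by rewrite /err ge_min lexx.
by move=> _ _; rewrite integral0.
Unshelve. all: by end_near. Qed.

(** By invariance [p A] is the [p]-average over y of the probabilities of A from y after n + 1
    steps, so the distance is at most the average of the pairwise errors. *)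
Let kernel_iter_tv n x A : T x -> measurable A ->
  (`| kernel_iter K n.+1 x A - p A | <= \int[p]_y (err x n y)%:E)%E.
Proof.
move=> Tx mA.
pose k y := kernel_iter K n.+1 y A.
have kE y : k y = (fine (k y))%:E by rewrite fineK// kernel_iter_fin_num.
have mk : measurable_fun setT k by exact: measurable_kernel_iter.
have k0 y : (0 <= k y)%E by exact: kernel_iter_ge0.
have mE : measurable_fun setT (fun y => (err x n y)%:E).
  exact/measurable_EFinP/measurable_err.
have e0 y : (0 <= (err x n y)%:E)%E by rewrite lee_fin err_ge0.
have pk : (\int[p]_y k y = p A)%E.
  by apply: integral_invariant_iter => //; exact: invariant_probabilityP.
have pc (r : \bar R) : (\int[p]_y cst r y = r)%E.
  by rewrite integral_cst// [X in (_ * X)%E](probability_setT p) mule1.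
have pfin : p A \is a fin_num by rewrite fin_num_measure.
have kfin : k x \is a fin_num by exact: kernel_iter_fin_num.
have up : (k x <= p A + \int[p]_y (err x n y)%:E)%E.
  rewrite -(pc (k x)) -pk -ge0_integralD//.
  apply: (null_le_integral mT invariant_probability_null) => //.
  - by move=> y; exact: k0.
  - by move=> y; rewrite adde_ge0.
  - exact: emeasurable_funD.
  - move=> y Ty; rewrite /= kE (kE y) -EFinD lee_fin.
    exact: kernel_iter_err.
have down : (p A <= k x + \int[p]_y (err x n y)%:E)%E.
  rewrite -{1}(pc (k x)) -pk -ge0_integralD//; last by move=> y _; exact: k0.
  apply: (null_le_integral mT invariant_probability_null) => //.
  - by move=> y; rewrite adde_ge0// k0.
  - exact: emeasurable_funD.
  - move=> y Ty; rewrite /= kE (kE x) -EFinD lee_fin.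
    by have := kernel_iter_err n Ty Tx mA; rewrite /err (addrC (W y)).
case: (\int[p]_y _)%E up down => [e||] up down.
- rewrite -/(k x); move: up down.
  rewrite -(fineK pfin) -(fineK kfin) -EFinN -!EFinD !lee_fin.
  by move=> up down; rewrite ler_norml; apply/andP; split; lra.
- by rewrite leey.
- by move: up kfin; rewrite addeNy leeNy_eq => /eqP ->.
Qed.

(** [q A] is the [q]-average of the (n + 1)-step probabilities of A, which tend to [p A] at every
    point of [T]. *)
Lemma invariant_probability_unique (q : probability X R) :
  q (~` T) = 0%E -> (forall A, measurable A -> (\int[q]_x K x A = q A)%E) ->
  forall A, measurable A -> q A = p A.
Proof.
move=> qT qK A mA.
have [] := @dominated_convergence _ _ _ q setT measurableT
  (fun n x => kernel_iter K n.+1 x A) (cst (p A)) (cst 1%E).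
- by move=> n; exact: measurable_kernel_iter.
- by [].
- apply: (null_ae_in mT qT) => x Tx.
  apply/cvge_sub0; first by rewrite fin_num_measure.
  apply/cvg_abse0P.
  apply: (@squeeze_cvge _ _ _ _ (cst 0%E) _ (fun n => \int[p]_y (err x n y)%:E)%E).
  + by apply: nearW => n; rewrite abse_ge0/= kernel_iter_tv.
  + exact: cvg_cst.
  + exact: err_cvg0.
- exact: (finite_measure_integrable_cst _ 1).
- apply: aeW => x n _; rewrite gee0_abs ?kernel_iter_ge0//.
  exact: kernel_iter_le1.
move=> _ _; rewrite integral_cst// [X in (_ * X)%E](probability_setT q) mule1.
have -> : [sequence \int[q]_x kernel_iter K n.+1 x A]_n%E = cst (q A).
  by apply/funext => n /=; exact: (integral_invariant_iter n.+1 qK mA).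
by move=> /cvg_lim <-//; rewrite lim_cst.
Qed.

(** The sequence [u] does not depend on [A]; this uniformity is what total variation requires. *)
Theorem drift_minorization_ergodic : exists p : probability X R,
  [/\ p (~` T) = 0%E,
      forall A, measurable A -> (\int[p]_x K x A = p A)%E,
      forall q : probability X R, q (~` T) = 0%E ->
        (forall A, measurable A -> (\int[q]_x K x A = q A)%E) ->
        forall A, measurable A -> q A = p A
    & forall x, T x -> exists2 u : nat -> \bar R, u @ \oo --> 0%E &
        forall n A, measurable A ->
          (`| kernel_iter K n.+1 x A - p A | <= u n)%E].
Proof.
exists invariant_probability; split.
- exact: invariant_probability_null.
- exact: invariant_probabilityP.
- exact: invariant_probability_unique.
- move=> x Tx; exists (fun n => \int[p]_y (err x n y)%:E)%E.
    exact: err_cvg0.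
  by move=> n A; exact: kernel_iter_tv.
Qed.

End harris.

Lemma step_distrE {R : realType}
    (K : R.-pker (measurableTypeR R) ~> (measurableTypeR R)) n x A :
  step_distr K n x A = kernel_iter K n x A.
Proof. by elim: n x => //= n IH x; apply: eq_integral => y _; exact: IH. Qed.

Lemma ergodic_on_of_kernel_iter {R : realType} (T : set (measurableTypeR R))
    (K : R.-pker (measurableTypeR R) ~> (measurableTypeR R)) :
  measurable T ->
  (exists p : probability (measurableTypeR R) R,
  [/\ p (~` T) = 0%E,
      forall A, measurable A -> (\int[p]_x K x A = p A)%E,
      forall q : probability (measurableTypeR R) R, q (~` T) = 0%E ->
        (forall A, measurable A -> (\int[q]_x K x A = q A)%E) ->
        forall A, measurable A -> q A = p A
    & forall x, T x -> exists2 u : nat -> \bar R, u @ \oo --> 0%E &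
        forall n A, measurable A ->
          (`| kernel_iter K n.+1 x A - p A | <= u n)%E]) ->
  ergodic_on T K.
Proof.
move=> mT [p [pT pK pU pE]].
have invE (q : probability (measurableTypeR R) R) : q (~` T) = 0%E ->
    forall A, measurable A -> (\int[q]_(x in T) K x A = \int[q]_x K x A)%E.
  by move=> qT A mA; apply: integral_null_compl => //; exact: measurable_kernel.
exists p; split.
- split; first exact/probability_null_compl.
  by move=> A mA; rewrite invE// pK.
- move=> q [/(probability_null_compl _ mT) qT qK].
  apply: pU => // A mA; rewrite -invE//; exact: qK.
- move=> x Tx; have [u u0 uE] := pE x Tx.
  (* The available bounds start at time 1. *)
  rewrite -cvg_shiftS.
  refine (squeeze_cvge (f := cst 0%E) (h := u) _ (@cvg_cst _ _ _ _ _) u0).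
  apply: nearW => n; apply/andP; split.
    (* The empty set witnesses that the supremum is nonnegative. *)
    apply: le_trans (_ : (`| step_distr K n.+1 x set0 - p set0 | <= _)%E).
      exact: abse_ge0.
    by apply: ereal_sup_ubound; exists set0 => //; exact: measurable0.
  apply: ge_ereal_sup => _ [A mA <-]; rewrite step_distrE; exact: uE.
Qed.

(** * The mean of the Gumbel distribution *)

(** Reduces means to tails, which are explicit for exponential maxima and comparable under
    stochastic domination. *)
Lemma integral_layer_cake {d} {X : measurableType d} {R : realType}
    (P : probability X R) (f : X -> R) :
  measurable_fun setT f -> (forall x, 0 <= f x) ->
  (\int[P]_x (f x)%:E =
   \int[lebesgue_measure]_(r in `[0%R, +oo[) P [set x | (r < f x)%R])%E.
Proof.
move=> mf f0.
have := @ge0_expectation_ccdf _ _ _ P (mfun_Sub (mem_set mf)) f0.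
rewrite expectation_def => ->.
apply: eq_integral => r _; rewrite /ccdf /distribution /pushforward.
by congr (P _); apply/seteqP; split => x /=; rewrite in_itv/= andbT.
Qed.

Section exponential_integrals.
Context {R : realType}.

(** The distribution function of the standard exponential law on the positive half-line, built from
    operations on functions so that its derivative is found by instance inference. *)
Let cexp : R -> R := cst 1 - (@expR R \o -%R).

Let cexpE x : cexp x = 1 - expR (- x).
Proof. by []. Qed.

Let is_derive_cexp (x : R) : is_derive x 1 cexp (expR (- x)).
Proof. by apply: is_derive_eq; rewrite sub0r mulrN1 opprK. Qed.

Let continuous_cexp : continuous cexp.
Proof.
move=> x; apply/differentiable_continuous/derivable1_diffP.
by have := is_derive_cexp x.
Qed.

Let cexp_ge0 x : 0 <= x -> 0 <= cexp x.
Proof. by move=> x0; rewrite cexpE subr_ge0 -expR0 ler_expR oppr_le0. Qed.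

Let cexp_le1 x : cexp x <= 1.
Proof. by rewrite cexpE gerBl expR_ge0. Qed.

Let cexp_cvg1 : cexp x @[x --> +oo%R] --> (1 : R).
Proof.
rewrite -[X in _ --> X]subr0; apply: cvgB; first exact: cvg_cst.
exact: cvgr_expR.
Qed.

Let continuous_cexp_exp m : continuous (fun x : R => cexp x ^+ m).
Proof.
move=> x; exact: (@continuous_comp _ _ _ cexp (fun y => y ^+ m) x
  (@continuous_cexp x) (@exprn_continuous _ m _)).
Qed.

Let continuous_exp_pow m : continuous (fun x : R => expR (- x) * cexp x ^+ m).
Proof.
move=> x; apply: cvgM.
  apply: (@continuous_comp _ _ _ -%R); first exact: opp_continuous.
  exact: continuous_expR.
exact: continuous_cexp_exp.
Qed.

Lemma integral_exp_onem_exp m :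
  (\int[lebesgue_measure]_(r in `[0%R, +oo[)
     (expR (- r) * (1 - expR (- r)) ^+ m)%:E = (m.+1%:R^-1)%:E :> \bar R)%E.
Proof.
pose F : R -> R := m.+1%:R^-1 \*: (cexp ^+ m.+1).
have FE x : F x = m.+1%:R^-1 * cexp x ^+ m.+1.
  by rewrite /F exprfctE.
have dF (x : R) : is_derive x 1 F (expR (- x) * cexp x ^+ m).
  apply: is_derive_eq; rewrite /= /GRing.scale /=.
  by rewrite mulrA mulKf ?pnatr_eq0// sub0r mulrN1 opprK mulrC.
rewrite (@ge0_continuous_FTC2y _ _ F 0 (m.+1%:R^-1)).
- by rewrite FE cexpE oppr0 expR0 subrr expr0n /= mulr0 sube0.
- by move=> x x0; rewrite mulr_ge0 ?expR_ge0// exprn_ge0// cexp_ge0.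
- exact/continuous_subspaceT/continuous_exp_pow.
- rewrite (funext FE : F = fun x => _).
  rewrite -[X in _ --> X]mulr1; apply: cvgM; first exact: cvg_cst.
  rewrite -[X in _ --> X](expr1n _ m.+1).
  exact: (@cvg_comp _ _ _ cexp (fun y => y ^+ m.+1) _ _ _ cexp_cvg1
    (@exprn_continuous _ m.+1 1)).
- by move=> x _; have [] := dF x.
- apply/cvg_at_right_filter/differentiable_continuous/derivable1_diffP.
  by have [] := dF 0.
- by move=> x _; rewrite derive1E; have [_ ->] := dF x.
Qed.

Definition harmonic_number m : R := \sum_(0 <= k < m) k.+1%:R^-1.

(** The integrand is the tail of the maximum of m independent standard exponential variables.
    Passing from m to m + 1 adds [exp (- r) (1 - exp (- r))^m], whose integral is [1 / (m + 1)]. *)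
Lemma integral_onem_onem_exp m :
  (\int[lebesgue_measure]_(r in `[0%R, +oo[)
     (1 - (1 - expR (- r)) ^+ m)%:E = (harmonic_number m)%:E :> \bar R)%E.
Proof.
elim: m => [|m IH].
  rewrite /harmonic_number big_geq//; apply: integral0_eq => r _.
  by rewrite expr0 subrr.
rewrite /harmonic_number big_nat_recr//= EFinD -IH -integral_exp_onem_exp.
have mf (f : R -> R) : continuous f ->
    measurable_fun (`[0, +oo[%classic : set (measurableTypeR R))
      (fun x => (f x)%:E).
  move=> cf; apply/measurable_funTS/measurable_EFinP.
  exact: continuous_measurable_fun.
rewrite -ge0_integralD//.
- apply: eq_integral => r _; rewrite -EFinD; congr (_%:E).
  by rewrite exprS; ring.
- move=> r /=; rewrite in_itv/= andbT => r0.
  by rewrite lee_fin subr_ge0 exprn_ile1// ?cexp_ge0// cexp_le1.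
- apply: mf => x; apply: cvgB; first exact: cvg_cst.
  exact: continuous_cexp_exp.
- move=> r /=; rewrite in_itv/= andbT => r0.
  by rewrite lee_fin mulr_ge0 ?expR_ge0// exprn_ge0// cexp_ge0.
- apply: (mf (fun x => expR (- x) * (1 - expR (- x)) ^+ m)); exact: continuous_exp_pow.
Qed.

End exponential_integrals.

Section gumbel.
Context {R : realType}.

Definition unif : probability (measurableTypeR R) R := uniform_prob (@ltr01 R).

Let U := unif.

Lemma unifE (A : set (measurableTypeR R)) : measurable A ->
  U A = lebesgue_measure (A `&` `[0, 1]).
Proof.
move=> mA; transitivity (\int[U]_x (\1_A x)%:E)%E.
  by rewrite integral_indic// setIT.
rewrite integral_uniform//.
- by rewrite subr0 invr1 mul1e integral_indic.
- exact/measurable_EFinP/measurable_indic.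
Qed.

Lemma unif_itv (a b : R) : 0 <= a -> a <= b -> b <= 1 ->
  U `]a, b[%classic = (b - a)%:E.
Proof.
move=> a0 ab b1; rewrite unifE// setIidl; last first.
  move=> x /=; rewrite !in_itv/= => /andP[ax xb].
  by rewrite (le_trans a0 (ltW ax)) (le_trans (ltW xb) b1).
rewrite lebesgue_measure_itv/= lte_fin.
case: ltgtP ab => [ab _| |<- _]; [by []|by []|by rewrite subrr].
Qed.

Let D : set (measurableTypeR R) := `]0, 1[%classic.

Lemma unif01 : U D = 1%E.
Proof. by rewrite /D unif_itv// subr0. Qed.

(* [-ln (1 - u^(1/m))] is distributed as the maximum of [m] independent
   standard exponential variables; it vanishes outside [(0, 1)] because
   [ln x = 0] for [x <= 0]. *)
Definition max_exp (m : nat) (u : R) : R := - ln (1 - expR (ln u / m%:R)).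

(** The maximum with 0 only matters for [u > 1], a null event, and makes the function nonnegative
    everywhere as the layer-cake formula demands. *)
Definition exp1 (u : R) : R := Num.max 0 (- ln u).

Definition gumbel (u : R) : R := - ln (- ln u).

Lemma measurable_max_exp m : measurable_fun [set: measurableTypeR R] (max_exp m).
Proof.
apply: measurable_funN; apply: measurableT_comp; first exact: measurable_ln.
apply: measurable_funB => //.
apply: measurableT_comp; first exact: measurable_expR.
by apply: measurable_funM => //; exact: measurable_ln.
Qed.

Lemma measurable_exp1 : measurable_fun [set: measurableTypeR R] exp1.
Proof.
apply: measurable_maxr => //; apply: measurable_funN; exact: measurable_ln.
Qed.

Lemma measurable_gumbel : measurable_fun [set: measurableTypeR R] gumbel.
Proof.
apply: measurable_funN; apply: measurableT_comp; first exact: measurable_ln.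
apply: measurable_funN; exact: measurable_ln.
Qed.

Lemma notin01_max_exp m u : ~ D u -> max_exp m u = 0.
Proof.
rewrite /D /= in_itv/= => /negP; rewrite negb_and -!leNgt /max_exp => /orP[u0|u1].
  by rewrite (ln0 u0) mul0r expR0 subrr ln0// oppr0.
rewrite ln0 ?oppr0// subr_le0 -expR0 ler_expR divr_ge0// ln_ge0//.
Qed.

Lemma notin01_gumbel u : ~ D u -> gumbel u = 0.
Proof.
rewrite /D /= in_itv/= => /negP; rewrite negb_and -!leNgt /gumbel => /orP[u0|u1].
  by rewrite (ln0 u0) oppr0 ln0// oppr0.
by rewrite [X in - X]ln0 ?oppr0// oppr_le0 ln_ge0.
Qed.

Lemma lnN_gt0 u : D u -> 0 < - ln u.
Proof. by rewrite /D /= in_itv/= => u01; rewrite oppr_gt0 ln_lt0. Qed.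

Lemma onem_exp_bounds m u : D u -> (0 < m)%N ->
  0 < 1 - expR (ln u / m%:R) < 1.
Proof.
move=> Du m0; have L0 := lnN_gt0 Du.
rewrite subr_gt0 -[X in _ < X]expR0 ltr_expR pmulr_llt0 ?invr_gt0 ?ltr0n//.
by rewrite -oppr_gt0 L0/= gtrBl expR_gt0.
Qed.

Lemma max_exp_ge0 m u : (0 < m)%N -> 0 <= max_exp m u.
Proof.
move=> m0; have [Du|nDu] := pselect (D u); last by rewrite notin01_max_exp.
have /andP[a0 a1] := onem_exp_bounds Du m0.
by rewrite oppr_ge0 ln_le0// ltW.
Qed.

Lemma exp1_ge0 u : 0 <= exp1 u.
Proof. by rewrite /exp1 le_max lexx. Qed.

Lemma max_exp_gt m r : (0 < m)%N -> 0 <= r ->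
  [set u | r < max_exp m u] = `](1 - expR (- r)) ^+ m, 1[%classic.
Proof.
move=> m0 r0.
have y0 : 0 <= 1 - expR (- r) by rewrite subr_ge0 -expR0 ler_expR oppr_le0.
apply/seteqP; split => u /=; rewrite in_itv/=.
  move=> ru; have [Du|nDu] := pselect (D u); last first.
    by move: ru; rewrite notin01_max_exp// ltNge r0.
  have /andP[a0 a1] := onem_exp_bounds Du m0.
  move: (Du); rewrite /D /= in_itv/= => /andP[u0 u1]; rewrite u1 andbT.
  move: ru; rewrite /max_exp ltrNr -ltr_expR lnK ?posrE// => ru.
  have su : expR (ln u / m%:R) ^+ m = u.
    by rewrite -expRM_natl mulrC divfK ?pnatr_eq0 -?lt0n// lnK.
  rewrite -su ltrXn2r// -?lt0n//.
  by lra.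
move=> /andP[yu u1].
have u0 : 0 < u by apply: le_lt_trans yu; rewrite exprn_ge0.
have Du : D u by rewrite /D /= in_itv/= u0.
have /andP[a0 a1] := onem_exp_bounds Du m0.
rewrite /max_exp ltrNr -ltr_expR lnK ?posrE//.
have su : expR (ln u / m%:R) ^+ m = u.
  by rewrite -expRM_natl mulrC divfK ?pnatr_eq0 -?lt0n// lnK.
move: yu; rewrite -{1}su ltr_pXn2r ?nnegrE ?expR_ge0//.
by lra.
Qed.

Lemma exp1_gt r : 0 <= r -> [set u | r < exp1 u] = `]0, expR (- r)[%classic.
Proof.
move=> r0; apply/seteqP; split => u /=; rewrite in_itv/= /exp1 lt_max.
  rewrite ltNge r0/= => ru.
  have u0 : 0 < u.
    by rewrite ltNge; apply/negP => u0; move: ru; rewrite ln0// oppr0 ltNge r0.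
  by rewrite u0/= -ltr_ln ?posrE ?expR_gt0// expRK; lra.
move=> /andP[u0]; rewrite -ltr_ln ?posrE ?expR_gt0// expRK => ur.
by apply/orP; right; lra.
Qed.

Lemma integral_max_exp m : (0 < m)%N ->
  (\int[U]_u (max_exp m u)%:E = (harmonic_number m)%:E)%E.
Proof.
move=> m0.
rewrite (integral_layer_cake _ (measurable_max_exp m)) => [|u]; last first.
  exact: max_exp_ge0.
rewrite -integral_onem_onem_exp; apply: eq_integral => r.
rewrite inE/= in_itv/= andbT => r0.
have y0 : 0 <= 1 - expR (- r) by rewrite subr_ge0 -expR0 ler_expR oppr_le0.
rewrite max_exp_gt// unif_itv// ?exprn_ge0// exprn_ile1//.
Qed.

Lemma integral_exp1 : (\int[U]_u (exp1 u)%:E = 1)%E.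
Proof.
rewrite (integral_layer_cake _ measurable_exp1 exp1_ge0).
rewrite -[RHS]/(1%:E) -[in RHS]invr1 -(integral_exp_onem_exp 0).
apply: eq_integral => r; rewrite inE/= in_itv/= andbT => r0.
rewrite exp1_gt// unif_itv// ?expR_ge0//.
- by rewrite expr0 mulr1 subr0.
- by rewrite -expR0 ler_expR oppr_le0.
Qed.

(* [x / (1 + x) <= 1 - exp (- x) <= x] at [x = - ln u / m]. *)
Lemma gumbel_max_exp m u : D u -> (0 < m)%N ->
  gumbel u <= max_exp m u - ln m%:R <= gumbel u + exp1 u / m%:R.
Proof.
move=> Du m0; have L0 := lnN_gt0 Du.
have /andP[a0 a1] := onem_exp_bounds Du m0.
have mR : 0 < m%:R :> R by rewrite ltr0n.
have -> : exp1 u = - ln u by rewrite /exp1; apply/max_idPr/ltW.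
rewrite /gumbel /max_exp; set L := - ln u in L0 *.
have -> : ln u / m%:R = - (L / m%:R) by rewrite /L mulNr opprK.
set x := L / m%:R.
have x0 : 0 < x by rewrite divr_gt0.
move: a0 a1; have -> : ln u / m%:R = - x by rewrite /x /L mulNr opprK.
move=> a0 a1.
have Lx : L = m%:R * x by rewrite /x mulrC divfK// gt_eqF.
have Lln : ln L = ln m%:R + ln x by rewrite Lx lnM ?posrE.
have up : 1 - expR (- x) <= x by have := expR_ge1Dx (- x); lra.
have lo : ln x - x <= ln (1 - expR (- x)).
  rewrite -[X in ln x - X]expRK -ln_div ?posrE ?expR_gt0//.
  rewrite ler_ln ?posrE ?divr_gt0 ?expR_gt0//.
  rewrite ler_pdivrMr ?expR_gt0// mulrBl mul1r -expRD addNr expR0.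
  by have := expR_ge1Dx x; lra.
have up' : ln (1 - expR (- x)) <= ln x by rewrite ler_ln.
by rewrite Lln; apply/andP; split; lra.
Qed.

Lemma integrable_max_exp m : (0 < m)%N -> U.-integrable setT (EFin \o max_exp m).
Proof.
move=> m0; apply/integrableP; split.
  by apply/measurable_EFinP; exact: measurable_max_exp.
under eq_integral do rewrite /= ger0_norm ?max_exp_ge0//.
by rewrite integral_max_exp// ltry.
Qed.

Lemma integrable_exp1 : U.-integrable setT (EFin \o exp1).
Proof.
apply/integrableP; split; first by apply/measurable_EFinP; exact: measurable_exp1.
under eq_integral do rewrite /= ger0_norm ?exp1_ge0//.
by rewrite integral_exp1 ltry.
Qed.

(** The bounds of [gumbel_max_exp] for m = 1, where [ln m = 0], dominate [|gumbel|] by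
    [max_exp 1 + exp1]. *)
Lemma integrable_gumbel : U.-integrable setT (EFin \o gumbel).
Proof.
apply: (@le_integrable _ _ _ U _ measurableT _
    (EFin \o (max_exp 1 \+ exp1))); last first.
- rewrite -[EFin \o _]/((EFin \o max_exp 1) \+ (EFin \o exp1))%E.
  by apply: integrableD => //; [exact: integrable_max_exp|exact: integrable_exp1].
- move=> u _ /=; rewrite lee_fin [leRHS]ger0_norm ?addr_ge0 ?max_exp_ge0 ?exp1_ge0//.
  have [Du|nDu] := pselect (D u); last first.
    by rewrite notin01_gumbel// normr0 addr_ge0 ?max_exp_ge0 ?exp1_ge0.
  have := gumbel_max_exp Du (ltn0Sn 0); rewrite ln1 subr0 divr1.
  have := max_exp_ge0 u (ltn0Sn 0); have := exp1_ge0 u.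
  by move=> ? ? /andP[? ?]; rewrite ler_norml; apply/andP; split; lra.
- by apply/measurable_EFinP; exact: measurable_gumbel.
Qed.

Lemma unif_null : U (~` D) = 0%E.
Proof. by apply/probability_null_compl; [exact: measurable_itv|exact: unif01]. Qed.

(** Allows integrating pointwise bounds that hold on (0, 1) only. *)
Lemma Rintegral01 (f : measurableTypeR R -> R) : U.-integrable setT (EFin \o f) ->
  \int[U]_(u in D) f u = \int[U]_u f u.
Proof.
move=> intf; rewrite /Rintegral.
have mD : measurable (~` D) by apply: measurableC; exact: measurable_itv.
rewrite [in RHS](negligible_integral mD measurableT intf unif_null).
by rewrite setDE setTI setCK.
Qed.

Let g := \int[U]_u gumbel u.

Lemma gumbel_mean_bounds m : (0 < m)%N ->
  g <= harmonic_number m - ln m%:R <= g + m%:R^-1.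
Proof.
move=> m0.
have mD : measurable D by exact: measurable_itv.
have iD (f : measurableTypeR R -> R) :
    U.-integrable setT (EFin \o f) -> U.-integrable D (EFin \o f).
  by move=> h; apply: integrableS h.
have ic (r : R) : U.-integrable setT (EFin \o cst r).
  exact: finite_measure_integrable_cst.
have Rc (r : R) : \int[U]_(u in D) cst r u = r.
  by rewrite Rintegral_cst// [X in fine X]unif01 mulr1.
have -> : harmonic_number m = \int[U]_(u in D) max_exp m u.
  by rewrite Rintegral01 ?integrable_max_exp// /Rintegral integral_max_exp.
have e1 : \int[U]_(u in D) exp1 u = 1.
  by rewrite Rintegral01 ?integrable_exp1// /Rintegral integral_exp1.
have -> : g = \int[U]_(u in D) gumbel u.
  by rewrite Rintegral01 ?integrable_gumbel.
have iM := iD _ (integrable_max_exp m0).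
have iG := iD _ integrable_gumbel.
have iE := iD _ integrable_exp1.
rewrite -(Rc (ln m%:R)) -RintegralB//; last exact/iD/ic.
have iEm : U.-integrable D (EFin \o (fun u => m%:R^-1 * exp1 u)).
  have -> : EFin \o (fun u => m%:R^-1 * exp1 u) =
      (fun u => (m%:R^-1)%:E * (EFin \o exp1) u)%E by [].
  exact: integrableZl.
have iMc : U.-integrable D (EFin \o (fun u => max_exp m u - cst (ln m%:R) u)).
  have -> : EFin \o (fun u => max_exp m u - cst (ln m%:R) u) =
      ((EFin \o max_exp m) \- (EFin \o cst (ln m%:R)))%E by [].
  by apply: integrableB => //; exact: iD.
have iGE : U.-integrable D (EFin \o (fun u => gumbel u + m%:R^-1 * exp1 u)).
  have -> : EFin \o (fun u => gumbel u + m%:R^-1 * exp1 u) =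
      ((EFin \o gumbel) \+ (EFin \o (fun u => m%:R^-1 * exp1 u)%R))%E by [].
  exact: integrableD.
have -> : m%:R^-1 = \int[U]_(u in D) (m%:R^-1 * exp1 u).
  by rewrite RintegralZl// e1 mulr1.
rewrite -RintegralD//; apply/andP; split; apply: le_Rintegral => // u Du.
- by have /andP[] := gumbel_max_exp Du m0.
- by have /andP[_] := gumbel_max_exp Du m0; rewrite [_ / _]mulrC.
Qed.

Lemma euler_gamma_gumbel : euler_gamma R = g.
Proof.
rewrite /euler_gamma; apply/cvg_lim => //; rewrite -cvg_shiftS.
apply: (@squeeze_cvgr _ _ _ _ (cst g) (fun n => g + harmonic n)).
- apply: nearW => n.
  have := gumbel_mean_bounds (ltn0Sn n).
  by rewrite /harmonic_number /= big_add1.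
- exact: cvg_cst.
- rewrite -[X in _ --> X]addr0; apply: cvgD; first exact: cvg_cst.
  exact: cvg_harmonic.
Qed.

(** This half of the identity suffices, as the Gumbel variable is on the larger side of the tail
    comparisons. *)
Lemma unif_gumbel_gt (t : R) :
  ((1 - expR (- expR (- t)))%:E <= U [set u | (t < gumbel u)%R])%E.
Proof.
have w1 : expR (- expR (- t)) <= 1.
  by rewrite -[leRHS]expR0 ler_expR oppr_le0 expR_ge0.
rewrite -unif_itv ?expR_ge0//; apply: le_measure; rewrite ?inE.
- exact: measurable_itv.
- have := measurable_gumbel measurableT (measurable_itv `]t, +oo[).
  rewrite setTI; congr measurable.
  by apply/seteqP; split => u /=; rewrite in_itv/= andbT.
- move=> u /=; rewrite in_itv/= => /andP[wu u1].
  have u0 : 0 < u := lt_trans (expR_gt0 _) wu.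
  have L0 : 0 < - ln u by rewrite oppr_gt0 ln_lt0// u0.
  rewrite /gumbel ltrNr -ltr_expR lnK// ltrNl -ltr_expR lnK//.
Qed.

Lemma unif_gumbel_lt (t : R) :
  ((expR (- expR t))%:E <= U [set u | (t < - gumbel u)%R])%E.
Proof.
have w1 : expR (- expR t) <= 1.
  by rewrite -[leRHS]expR0 ler_expR oppr_le0 expR_ge0.
rewrite -[X in X%:E]subr0 -unif_itv ?expR_ge0//; apply: le_measure; rewrite ?inE.
- exact: measurable_itv.
- have := measurable_gumbel measurableT (measurable_itv `]-oo, - t[).
  rewrite setTI; congr measurable.
  by apply/seteqP; split => u /=; rewrite in_itv/= ltrNr.
- move=> u /=; rewrite in_itv/= => /andP[u0 uw].
  have u1 : u < 1 := lt_le_trans uw w1.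
  have L0 : 0 < - ln u by rewrite oppr_gt0 ln_lt0// u0.
  by rewrite /gumbel opprK -ltr_expR lnK// ltrNr -ltr_expR lnK.
Qed.

End gumbel.

(** * Drift under stochastic domination *)

Section huber.
Context {R : realType}.
Implicit Types L s t r : R.

(* The slope of [huber L] grows from 0 to 1 at rate [1 / L], so that the second-order
   term of the drift vanishes as [L] tends to infinity. *)
Definition huber L t : R :=
  if t <= 0 then 0 else if t <= L then t ^+ 2 / (2 * L) else t - L / 2.

Definition huber_slope L t : R :=
  if t <= 0 then 0 else if t <= L then t / L else 1.

(** Multiplication by [2 * L] removes the divisions and leaves polynomial inequalities in each
    case. *)
Lemma huber_sqr L t : 0 < L -> 2 * L * huber L t =
  if t <= 0 then 0 else if t <= L then t ^+ 2 else 2 * L * t - L ^+ 2.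
Proof.
move=> L0; rewrite /huber; case: ifP => _; first by rewrite mulr0.
by case: ifP => _; field; rewrite ?gt_eqF.
Qed.

Lemma huber_slope_mul L t : 0 < L -> L * huber_slope L t =
  if t <= 0 then 0 else if t <= L then t else L.
Proof.
move=> L0; rewrite /huber_slope; case: ifP => _; first by rewrite mulr0.
by case: ifP => _; [field; rewrite gt_eqF|rewrite mulr1].
Qed.

Lemma huber_ge0 L t : 0 < L -> 0 <= huber L t.
Proof.
move=> L0; rewrite /huber; case: ifPn => // t0; case: ifPn => tL.
  by rewrite divr_ge0 ?sqr_ge0// mulr_ge0// ltW.
by move: tL; rewrite -ltNge; lra.
Qed.

Lemma huber_slope_ge0 L t : 0 < L -> 0 <= huber_slope L t.
Proof.
move=> L0; rewrite /huber_slope; case: ifPn => //; rewrite -ltNge => t0.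
by case: ifPn => // _; rewrite divr_ge0// ltW.
Qed.

Lemma huber_slope_ge L t : L <= t -> 0 < L -> huber_slope L t = 1.
Proof.
move=> Lt L0; rewrite /huber_slope ifF; last by apply/negbTE; rewrite -ltNge; lra.
case: ifPn => // tL; have -> : t = L by apply/eqP; rewrite eq_le tL.
by rewrite divff// gt_eqF.
Qed.

(** The inverse of [huber L] on the positive half-line; [L / 2] is its value at the junction
    [t = L]. *)
Definition huber_inv L r : R :=
  if r <= L / 2 then Num.sqrt (2 * L * r) else r + L / 2.

Lemma huber_inv_ge0 L r : 0 < L -> 0 <= r -> 0 <= huber_inv L r.
Proof.
move=> L0 r0; rewrite /huber_inv; case: ifP => _; first exact: sqrtr_ge0.
by lra.
Qed.

Lemma huber_gt L r t : 0 < L -> 0 <= r -> (r < huber L t) = (huber_inv L r < t).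
Proof.
move=> L0 r0.
have i0 := huber_inv_ge0 L0 r0.
have L2 : 0 < 2 * L by lra.
have [t0|t0] := leP t 0.
  by rewrite /huber t0 !ltNge r0 (le_trans t0 i0).
rewrite /huber leNgt t0/=.
have [tL|tL] := leP t L; rewrite /huber_inv.
  rewrite ltr_pdivlMr// mulrC.
  have [rL|rL] := leP r (L / 2).
    rewrite -[X in _ = (_ < X)]ger0_norm ?ltW// -sqrtr_sqr ltr_sqrt//.
    by rewrite exprn_gt0.
  apply/idP/idP => ?; last by lra.
  have : t ^+ 2 <= L ^+ 2 by rewrite ler_sqr ?nnegrE// ltW.
  by nra.
have [rL|rL] := leP r (L / 2); last first.
  by apply/idP/idP; lra.
have -> : r < t - L / 2 by lra.
apply/esym; apply: le_lt_trans tL.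
have : Num.sqrt (2 * L * r) <= Num.sqrt (L ^+ 2).
  by apply: ler_wsqrtr; rewrite expr2; nra.
by rewrite sqrtr_sqr ger0_norm// ltW.
Qed.

(** Taylor's bound, multiplied by [2 * L]: the slope is Lipschitz with constant [1 / L]. *)
Lemma huber_taylor L s t : 0 < L ->
  2 * L * huber L s <=
  2 * L * huber L t + 2 * (L * huber_slope L t) * (s - t) + (s - t) ^+ 2.
Proof.
move=> L0; rewrite !huber_sqr// huber_slope_mul//.
have q0 : 0 <= (s - t) ^+ 2 by exact: sqr_ge0.
have [s0|s0] := leP s 0; have [t0|t0] := leP t 0;
  have [sL|sL] := leP s L; have [tL|tL] := leP t L; first [lra|nra].
Qed.

Lemma huber_lipschitz L s t : 0 < L -> huber L s <= huber L t + `|s - t|.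
Proof.
move=> L0.
have st : s - t <= `|s - t| := ler_norm _.
have n0 : 0 <= `|s - t| := normr_ge0 _.
rewrite -(ler_pM2l (_ : 0 < 2 * L)) ?mulr_gt0// mulrDr !huber_sqr//.
have [s0|s0] := leP s 0; have [t0|t0] := leP t 0;
  have [sL|sL] := leP s L; have [tL|tL] := leP t L; first [lra|nra].
Qed.

Lemma huber_slope_le1 L t : 0 < L -> huber_slope L t <= 1.
Proof.
move=> L0; rewrite /huber_slope; case: ifPn => // t0; case: ifPn => // tL.
by rewrite ler_pdivrMr// mul1r.
Qed.

(** The quadratic remainder vanishes as L grows but needs a second moment; the bound [2 * |x|], from
    slopes at most 1, needs only a first moment. Their minimum has both advantages. *)
Lemma huber_expansion L t x : 0 < L -> huber L (t + x) <=
  huber L t + huber_slope L t * x + Num.min (2 * `|x|) (x ^+ 2 / (2 * L)).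
Proof.
move=> L0; have L2 : 0 < 2 * L by lra.
have s0 := huber_slope_ge0 t L0; have s1 := huber_slope_le1 t L0.
have tx : t + x - t = x by ring.
have [_|_] := leP (2 * `|x|) _.
  have := huber_lipschitz (t + x) t L0; rewrite tx => H.
  have : - huber_slope L t * x <= `|x|.
    rewrite (le_trans (ler_norm _))// normrM normrN (ger0_norm s0).
    by rewrite ler_piMl.
  by lra.
have := huber_taylor (t + x) t L0; rewrite tx => H.
rewrite -(ler_pM2l L2) !mulrDr.
have -> : 2 * L * (x ^+ 2 / (2 * L)) = x ^+ 2 by field; rewrite gt_eqF.
by lra.
Qed.

Lemma measurable_huber L : measurable_fun [set: measurableTypeR R] (huber L).
Proof.
apply: measurable_fun_ifT => //.
- exact: measurable_fun_ler.
- apply: measurable_fun_ifT.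
  + exact: measurable_fun_ler.
  + by apply: measurable_funM => //; exact: measurable_funX.
  + exact: measurable_funB.
Qed.

End huber.

Lemma measurable_tail {d} {X : measurableType d} {R : realType}
    (P : probability X R) (f : X -> R) : measurable_fun setT f ->
  measurable_fun [set: measurableTypeR R] (fun r => P [set x | r < f x]).
Proof.
move=> mf.
have := @ccdf_measurable _ _ _ P (mfun_Sub (mem_set mf)).
congr measurable_fun; apply/funext => r; rewrite /ccdf /distribution /pushforward.
by congr (P _); apply/seteqP; split => x /=; rewrite in_itv/= andbT.
Qed.

Section huber_drift.
Context d d' (X : measurableType d) (Y : measurableType d') (R : realType).
Context (P : probability X R) (Q : probability Y R) (S : X -> R) (xi : Y -> R).
Hypotheses (mS : measurable_fun setT S).
Hypothesis int_xi : Q.-integrable setT (EFin \o xi).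

Let mxi : measurable_fun setT xi.
Proof. exact/measurable_EFinP/(measurable_int Q). Qed.

(** Domination of the tails above [a] is enough, because [huber L (t - a)] vanishes for [t <= a]. *)
Lemma integral_huber_le L a s : 0 < L ->
  (forall t, a <= t ->
    (P [set x | (t < S x)%R] <= Q [set y | (t < s + xi y)%R])%E) ->
  (\int[P]_x (huber L (S x - a))%:E <= \int[Q]_y (huber L (s - a + xi y))%:E)%E.
Proof.
move=> L0 PQ.
have mhS : measurable_fun setT (fun x => huber L (S x - a)).
  apply: (measurableT_comp (@measurable_huber R L)).
  exact: measurable_funB.
have mhZ : measurable_fun setT (fun y => huber L (s - a + xi y)).
  apply: (measurableT_comp (@measurable_huber R L)).
  exact: measurable_funD.
rewrite (integral_layer_cake _ mhS) => [|x]; last exact: huber_ge0.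
rewrite (integral_layer_cake _ mhZ) => [|y]; last exact: huber_ge0.
apply: ge0_le_integral => //.
- by apply: measurable_funTS; exact: measurable_tail.
- by apply: measurable_funTS; exact: measurable_tail.
move=> r /=; rewrite in_itv/= andbT => r0.
have -> : [set x | r < huber L (S x - a)] = [set x | a + huber_inv L r < S x].
  by apply/seteqP; split => x /=; rewrite huber_gt// ltrBrDl.
have -> : [set y | r < huber L (s - a + xi y)] =
    [set y | a + huber_inv L r < s + xi y].
  by apply/seteqP; split => y /=; rewrite huber_gt// -ltrBrDl addrAC.
by apply: PQ; rewrite lerDl huber_inv_ge0.
Qed.

Definition huber_remainder L : \bar R :=
  (\int[Q]_y (Num.min (2 * `|xi y|) (xi y ^+ 2 / (2 * L)))%:E)%E.

Let rem L y := Num.min (2 * `|xi y|) (xi y ^+ 2 / (2 * L)).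

Let rem_ge0 L y : 0 < L -> 0 <= rem L y.
Proof.
move=> L0; rewrite /rem le_min mulr_ge0//= divr_ge0 ?sqr_ge0//.
by rewrite mulr_ge0// ltW.
Qed.

Let measurable_rem L : measurable_fun setT (rem L).
Proof.
apply: measurable_minr.
- apply: measurable_funM => //; exact: measurableT_comp.
- apply: measurable_funM => //; exact: measurable_funX.
Qed.

Let integrable_xi2 : Q.-integrable setT (fun y => (2 * `|xi y|)%:E).
Proof.
have -> : (fun y => (2 * `|xi y|)%:E) =
    (fun y => 2%:E * (abse \o (EFin \o xi)) y)%E.
  by apply/funext => y; rewrite EFinM.
by apply: integrableZl => //; exact: integrable_abse.
Qed.

Let integrable_rem L : 0 < L -> Q.-integrable setT (EFin \o rem L).
Proof.
move=> L0; apply: le_integrable integrable_xi2 => //.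
- exact/measurable_EFinP.
- move=> y _ /=; rewrite lee_fin (ger0_norm (rem_ge0 y L0)) ger0_norm ?mulr_ge0//.
  by rewrite /rem ge_min lexx.
Qed.

(** Pointwise the remainder is of order [1 / L], and it is dominated by the integrable function
    [2 * |xi|]. *)
Lemma huber_remainder_cvg0 : huber_remainder n.+1%:R @[n --> \oo] --> 0%E.
Proof.
have [] := @dominated_convergence _ _ _ Q setT measurableT
  (fun n y => (rem n.+1%:R y)%:E) (cst 0%E) (fun y => (2 * `|xi y|)%:E).
- by move=> n; exact/measurable_EFinP.
- by [].
- apply: aeW => y _; apply: cvg_EFin; first exact: nearW.
  apply: (@squeeze_cvgr _ _ _ _ (cst 0) (fun n => xi y ^+ 2 / 2 * harmonic n)).
  + apply: nearW => n; rewrite [X in X <= _]/= rem_ge0//= /rem ge_min.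
    by rewrite invfM mulrA lexx orbT.
  + exact: cvg_cst.
  + rewrite -[X in _ --> X](mulr0 (xi y ^+ 2 / 2)); apply: cvgMr.
    exact: cvg_harmonic.
- exact: integrable_xi2.
- apply: aeW => y n _; rewrite gee0_abs ?lee_fin ?rem_ge0//.
  by rewrite /rem ge_min lexx.
by move=> _ _; rewrite integral0.
Qed.

Lemma huber_drift L a s m : 0 < L -> (\int[Q]_y (xi y)%:E = m%:E)%E ->
  (forall t, a <= t ->
    (P [set x | (t < S x)%R] <= Q [set y | (t < s + xi y)%R])%E) ->
  (\int[P]_x (huber L (S x - a))%:E <=
   (huber L (s - a) + huber_slope L (s - a) * m)%:E + huber_remainder L)%E.
Proof.
move=> L0 xim PQ; apply: (le_trans (integral_huber_le L0 PQ)).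
pose c1 := huber L (s - a); pose c2 := huber_slope L (s - a).
have -> : ((huber L (s - a) + huber_slope L (s - a) * m)%:E + huber_remainder L =
    \int[Q]_y (c1%:E + c2%:E * (xi y)%:E + (rem L y)%:E))%E.
  have ic1 : Q.-integrable setT (cst c1%:E) by exact: finite_measure_integrable_cst.
  have ic2 : Q.-integrable setT (fun y => c2%:E * (xi y)%:E)%E.
    exact: integrableZl.
  have irem := integrable_rem L0.
  rewrite integralD//; last exact: integrableD.
  rewrite integralD// integralZl// xim integral_cst//.
  by rewrite [X in (c1%:E * X)%E](probability_setT Q) mule1 -EFinM -EFinD.
apply: ge0_le_integral => //.
- by move=> y _; rewrite lee_fin huber_ge0.
- apply/measurable_EFinP.
  apply: (measurableT_comp (@measurable_huber R L)); exact: measurable_funD.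
- have -> : (fun y => c1%:E + c2%:E * (xi y)%:E + (rem L y)%:E)%E =
      (fun y => (c1 + c2 * xi y + rem L y)%:E).
    by apply/funext => y; rewrite -EFinM -!EFinD.
  apply/measurable_EFinP; apply: measurable_funD => //.
  by apply: measurable_funD => //; exact: measurable_funM.
- by move=> y _; rewrite -EFinM -!EFinD lee_fin; exact: huber_expansion.
Qed.

End huber_drift.

(** * The transition kernel *)

Section powR_lemmas.
Context {R : realType}.
Implicit Types p q r e a b : R.

Lemma powR_bernoulli r e : 0 <= r -> 1 <= e -> 1 + e * (r - 1) <= r `^ e.
Proof.
move=> r0 e1; have [a0|a0] := leP (1 + e * (r - 1)) 0.
  exact: le_trans (powR_ge0 _ _).
move: r0; rewrite le_eqVlt => /predU1P[r0|r0].
  by move: a0; rewrite -r0; lra.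
rewrite -ler_ln ?posrE ?powR_gt0// ln_powR.
set a := 1 + _ in a0 *.
have la : ln a - ln r <= a / r - 1.
  rewrite -ln_div ?posrE//.
  have := @le_ln1Dx R (a / r - 1); rewrite addrCA subrr addr0; apply.
  by have := divr_gt0 a0 r0; lra.
have lr : - ln r <= r^-1 - 1.
  rewrite -lnV ?posrE//.
  have := @le_ln1Dx R (r^-1 - 1); rewrite addrCA subrr addr0; apply.
  by have : 0 < r^-1 by [rewrite invr_gt0]; lra.
have : (e - 1) * - ln r <= (e - 1) * (r^-1 - 1) by rewrite ler_wpM2l// subr_ge0.
have : a / r - 1 + (e - 1) * (r^-1 - 1) = 0.
  by rewrite /a; field; rewrite gt_eqF.
by lra.
Qed.

Lemma powR_le1 p e : 0 <= p -> p <= 1 -> 0 <= e -> p `^ e <= 1.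
Proof.
move=> p0 p1 e0; have -> : 1 = 1 `^ e :> R by rewrite powR1.
by apply: ge0_ler_powR; rewrite ?nnegrE.
Qed.

(** Bernoulli's inequality at [p / q], multiplied by [q^e], which is at most [q]. *)
Lemma powR_onem_ratio p q e : 0 <= p -> p <= q -> q <= 1 -> 1 <= e ->
  q `^ e - p `^ e <= e * (q - p).
Proof.
move=> p0 pq q1 e1.
have q0 := le_trans p0 pq.
move: q0; rewrite le_eqVlt => /predU1P[q0|q0].
  have -> : p = 0 by apply/eqP; rewrite eq_le p0 andbT q0.
  by rewrite -q0 !subrr mulr0.
have r0 : 0 <= p / q by rewrite divr_ge0// ltW.
have := powR_bernoulli r0 e1.
have qe : 0 <= q `^ e := powR_ge0 _ _.
have qp : q `^ e * (p / q) `^ e = p `^ e.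
  by rewrite -powRM ?(ltW q0)//; congr (_ `^ _); field; rewrite gt_eqF.
move=> /(ler_wpM2l qe); rewrite qp => H.
have qe1 : q `^ e <= q by apply: ge1r_powR; rewrite ?q0.
have -> : q - p = q * (1 - p / q) by field; rewrite gt_eqF.
have pq1 : 0 <= 1 - p / q by rewrite subr_ge0 ler_pdivrMr// mul1r.
have : q `^ e * (e * (1 - p / q)) <= q * (e * (1 - p / q)).
  by rewrite ler_wpM2r// mulr_ge0//; lra.
by lra.
Qed.

(** The substitution of [p^a], [q^a] for [p], [q] reduces to the exponent [b / a], which is at least
    1. *)
Lemma powR_diff_ratio p q a b : 0 <= p -> p <= q -> q <= 1 -> 0 < a -> a <= b ->
  a * (q `^ b - p `^ b) <= b * (q `^ a - p `^ a).
Proof.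
move=> p0 pq q1 a0 ab.
have q0 := le_trans p0 pq.
have e1 : 1 <= b / a by rewrite ler_pdivlMr// mul1r.
have -> : b = a * (b / a) by field; rewrite gt_eqF.
rewrite (powRrM q) (powRrM p) -mulrA ler_pM2l//.
apply: powR_onem_ratio => //.
- exact: powR_ge0.
- by apply: ge0_ler_powR; rewrite ?nnegrE// ltW.
- by apply: powR_le1 => //; exact: ltW.
Qed.

Lemma cvg_powR (u : nat -> R) p e : 0 < e -> (forall n, 0 <= u n) -> 0 <= p ->
  u @ \oo --> p -> u n `^ e @[n --> \oo] --> p `^ e.
Proof.
move=> e0 u0; rewrite le_eqVlt => /predU1P[<-|p0] up.
  (* The power need not be differentiable at 0, so continuity there is checked directly. *)
  rewrite powR0 ?gt_eqF//; apply/cvgr0Pnorm_lt => eps eps0.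
  have d0 : 0 < eps `^ e^-1 by rewrite powR_gt0.
  near=> n; rewrite ger0_norm ?powR_ge0//.
  have -> : eps = (eps `^ e^-1) `^ e.
    by rewrite -powRrM mulVf ?gt_eqF// powRr1// ltW.
  apply: gt0_ltr_powR => //; rewrite ?nnegrE ?powR_ge0//.
  rewrite -[X in X < _]ger0_norm//.
  by near: n; move/cvgr0Pnorm_lt : up; apply.
have cp : {for p, continuous (@powR R ^~ e)}.
  apply/differentiable_continuous/derivable1_diffP.
  by apply: derivable_powR; rewrite in_itv/= p0.
exact: (cvg_comp _ _ up cp).
Unshelve. all: by end_near. Qed.

End powR_lemmas.

Section power_mixture.
Context {R : realType} (G : probability (measurableTypeR R) R).

Let D : set (measurableTypeR R) := `]0, +oo[%classic.

Let mD : measurable D. Proof. exact: measurable_itv. Qed.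

Hypothesis G_pos : G D = 1%E.

(* The paper's [E (F(y)^(x nu))] is [power_mixture G x (distr_fun F y)]. *)
Definition power_mixture (c p : R) : R := \int[G]_(v in D) (p `^ (c * v)).

Lemma integrable_power_mixture c p : 0 < c -> 0 <= p -> p <= 1 ->
  G.-integrable D (EFin \o (fun v => p `^ (c * v))).
Proof.
move=> c0 p0 p1.
apply: (@le_integrable _ _ _ _ _ mD _ (cst 1%E)).
- apply/measurable_EFinP/measurable_funTS.
  apply: (measurableT_comp (measurable_powRr p)).
  exact: measurable_funM.
- move=> v; rewrite /D /= in_itv/= andbT => v0.
  rewrite lee_fin normr1 ger0_norm ?powR_ge0//.
  by rewrite powR_le1// mulr_ge0// ltW.
- apply: (@integrableS _ _ _ _ setT) => //.
  exact: (finite_measure_integrable_cst _ 1).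
Qed.

Lemma power_mixtureE c p : 0 < c -> 0 <= p -> p <= 1 ->
  (\int[G]_v (p `^ (c * v))%:E)%E = (power_mixture c p)%:E.
Proof.
move=> c0 p0 p1; rewrite /power_mixture /Rintegral fineK.
  apply/esym/integral_null_compl => //.
  - by apply/probability_null_compl.
  - by move=> v; rewrite lee_fin powR_ge0.
  - apply/measurable_EFinP; apply: (measurableT_comp (measurable_powRr p)).
    exact: measurable_funM.
by apply: integrable_fin_num => //; exact: integrable_power_mixture.
Qed.

Lemma power_mixture_ge0 c p : 0 <= power_mixture c p.
Proof. by apply: Rintegral_ge0 => v _; exact: powR_ge0. Qed.

Lemma power_mixture_nondecreasing c p q : 0 < c -> 0 <= p -> p <= q -> q <= 1 ->
  power_mixture c p <= power_mixture c q.
Proof.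
move=> c0 p0 pq q1; apply: le_Rintegral => //.
- by apply: integrable_power_mixture => //; exact: le_trans q1.
- by apply: integrable_power_mixture => //; exact: le_trans pq.
- move=> v; rewrite /D /= in_itv/= andbT => v0.
  apply: ge0_ler_powR; rewrite ?nnegrE//; last exact: le_trans pq.
  by rewrite mulr_ge0// ltW.
Qed.

Lemma power_mixture0 c : 0 < c -> power_mixture c 0 = 0.
Proof.
move=> c0; rewrite /power_mixture (@eq_Rintegral _ _ _ G D (cst 0)).
  by rewrite Rintegral_cst// mul0r.
move=> v; rewrite inE /D /= in_itv/= andbT => v0.
by rewrite powR0// gt_eqF// mulr_gt0.
Qed.

Lemma power_mixture_ratio a b p q : 0 < a -> a <= b ->
  0 <= p -> p <= q -> q <= 1 ->
  a * (power_mixture b q - power_mixture b p) <=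
  b * (power_mixture a q - power_mixture a p).
Proof.
move=> a0 ab p0 pq q1.
have b0 : 0 < b by exact: lt_le_trans ab.
have q0 := le_trans p0 pq; have p1 := le_trans pq q1.
have i c r := @integrable_power_mixture c r.
rewrite -!RintegralB ?i//.
have iB c : 0 < c ->
    G.-integrable D (EFin \o (fun v => q `^ (c * v) - p `^ (c * v))).
  move=> c0; have -> : EFin \o (fun v => q `^ (c * v) - p `^ (c * v)) =
    ((EFin \o (fun v => q `^ (c * v))%R) \-
     (EFin \o (fun v => p `^ (c * v))%R))%E by [].
  by apply: integrableB => //; exact: i.
rewrite -!RintegralZl ?iB//; apply: le_Rintegral => //.
- have -> : EFin \o (fun v => a * (q `^ (b * v) - p `^ (b * v))) =
    (fun v => a%:E *
      (EFin \o (fun v => (q `^ (b * v) - p `^ (b * v))%R)) v)%E by [].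
  by apply: integrableZl => //; exact: iB.
- have -> : EFin \o (fun v => b * (q `^ (a * v) - p `^ (a * v))) =
    (fun v => b%:E *
      (EFin \o (fun v => (q `^ (a * v) - p `^ (a * v))%R)) v)%E by [].
  by apply: integrableZl => //; exact: iB.
- move=> v; rewrite /D /= in_itv/= andbT => v0.
  (* Multiplying by v turns the coefficients a and b into the exponents [a * v] and [b * v]. *)
  rewrite -(ler_pM2r v0) -![_ * _ * v]mulrAC.
  by apply: powR_diff_ratio => //; rewrite ?mulr_gt0// ler_pM2r.
Qed.

Lemma power_mixture_cvg (c p : R) (u : nat -> R) : 0 < c ->
  (forall n, 0 <= u n <= 1) -> 0 <= p -> p <= 1 -> u @ \oo --> p ->
  power_mixture c (u n) @[n --> \oo] --> power_mixture c p.
Proof.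
move=> c0 u01 p0 p1 up; apply: fine_cvg; rewrite fineK; last first.
  by apply: integrable_fin_num => //; exact: integrable_power_mixture.
have [] := @dominated_convergence _ _ _ G D mD
  (fun n v => (u n `^ (c * v))%:E) (fun v => (p `^ (c * v))%:E) (cst 1%E) => //.
- move=> n; apply: (measurable_int G).
  by have /andP[] := u01 n; exact: integrable_power_mixture.
- apply: (measurable_int G).
  exact: integrable_power_mixture.
- apply: aeW => v; rewrite /D /= in_itv/= andbT => v0.
  apply: cvg_EFin; first exact: nearW.
  apply: cvg_powR => //; first exact: mulr_gt0.
  by move=> n; have /andP[] := u01 n.
- apply: (@integrableS _ _ _ _ setT) => //.
  exact: (finite_measure_integrable_cst _ 1).
- apply: aeW => v n; rewrite /D /= in_itv/= andbT => v0.
  rewrite lee_fin ger0_norm ?powR_ge0//.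
  by have /andP[? ?] := u01 n; rewrite powR_le1// mulr_ge0// ltW.
Qed.

End power_mixture.

Section distribution_functions.
Context {R : realType}.
Implicit Types (mu : probability (measurableTypeR R) R) (y : R).

Lemma distr_funE mu y : (distr_fun mu y)%:E = mu `]-oo, y]%classic.
Proof. by rewrite /distr_fun fineK// fin_num_measure. Qed.

Lemma distr_fun_ge0 mu y : 0 <= distr_fun mu y.
Proof. by rewrite -lee_fin distr_funE. Qed.

Lemma distr_fun_le1 mu y : distr_fun mu y <= 1.
Proof. by rewrite -lee_fin distr_funE probability_le1. Qed.

Lemma distr_fun_nondecreasing mu : nondecreasing (distr_fun mu).
Proof.
move=> x y xy; rewrite -lee_fin !distr_funE le_measure ?inE//.
by move=> z /=; rewrite !in_itv/= => zx; exact: le_trans xy.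
Qed.

Lemma distr_fun_right_continuous mu : right_continuous (distr_fun mu).
Proof.
move=> y.
pose id' (x : measurableTypeR R) : R := x.
have mid : measurable_fun [set: measurableTypeR R] id' by exact: measurable_id.
pose X : {RV mu >-> R} := @mfun_Sub _ _ _ _ id' (mem_set mid).
apply: fine_cvg; rewrite [X in _ --> X]distr_funE.
exact: (@cdf_right_continuous _ _ _ mu X y).
Qed.

Lemma cvg_measure_left mu (s : R) :
  mu `]-oo, s - n.+1%:R^-1]%classic @[n --> \oo] --> mu `]-oo, s[%classic.
Proof.
have -> : `]-oo, s[%classic = \bigcup_n `]-oo, s - n.+1%:R^-1]%classic.
  apply/seteqP; split => [z /=|z [n _] /=]; rewrite !in_itv/=; last first.
    by move=> /le_lt_trans; apply; rewrite gtrBl.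
  move=> zs; have d0 : 0 < s - z by rewrite subr_gt0.
  have [n _ nd] := near_infty_natSinv_lt (PosNum d0).
  exists n => //=; rewrite in_itv/=.
  have h : n.+1%:R^-1 < s - z := nd n (leqnn n).
  by rewrite lerBrDl -lerBrDr ltW.
apply: nondecreasing_cvg_mu => //.
- by apply: bigcup_measurable.
- move=> m n mn; apply/subsetPset => z /=; rewrite !in_itv/= => /le_trans; apply.
  by rewrite lerD2l lerN2 lef_pV2 ?posrE// ler_nat.
Qed.

(** [T] has no point in [s, y], so the mass up to [y] is the mass strictly below [s], a limit from
    the left. *)
Lemma distr_fun_cvg_support mu (T : set (measurableTypeR R)) y s (u : nat -> R) :
  measurable T -> mu (~` T) = 0%E ->
  s <= y -> (forall t, T t -> t <= y -> t < s) ->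
  (forall n, s - n.+1%:R^-1 < u n) -> (forall n, u n <= y) ->
  distr_fun mu (u n) @[n --> \oo] --> distr_fun mu y.
Proof.
move=> mT muT sy ATs su uy; apply: fine_cvg; rewrite [X in _ --> X]distr_funE.
have muE : mu `]-oo, y]%classic = mu `]-oo, s[%classic.
  apply/eqP; rewrite eq_le; apply/andP; split; last first.
    rewrite le_measure ?inE// => z /=; rewrite !in_itv/= => zs.
    exact: le_trans (ltW zs) sy.
  apply: (le_measure_null_compl mT _ _ muT) => //.
  by move=> z [] /=; rewrite !in_itv/= => zy Tz; exact: ATs.
rewrite muE.
refine (squeeze_cvge (f := fun n => mu `]-oo, s - n.+1%:R^-1]%classic)
  (h := cst (mu `]-oo, s[%classic)) _ (@cvg_measure_left mu s)
  (@cvg_cst _ _ _ _ _)).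
apply: nearW => n; apply/andP; split.
  rewrite le_measure ?inE// => z /=; rewrite !in_itv/= => /le_trans; apply.
  exact: ltW.
rewrite /= -muE le_measure ?inE// => z /=; rewrite !in_itv/= => /le_trans; apply.
exact: uy.
Qed.

End distribution_functions.

Section mbpplre_kernel.
Context {R : realType} (T : set (measurableTypeR R)).
Context (F G : probability (measurableTypeR R) R).
Context (K : R.-pker (measurableTypeR R) ~> (measurableTypeR R)).
Hypotheses (mT : measurable T) (T_pos : T `<=` `]0, +oo[%classic).
Hypotheses (F_T : F T = 1%E) (G_pos : G `]0, +oo[%classic = 1%E).
Hypothesis KT : MBPPLRE_kernel T F G K.

Let FnT : F (~` T) = 0%E.
Proof. exact/probability_null_compl. Qed.

Let T_gt0 x : T x -> 0 < x.
Proof. by move=> /T_pos /=; rewrite in_itv/= andbT. Qed.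

Let KnT x : T x -> K x (~` T) = 0%E.
Proof. by move=> Tx; apply: null_outside mT _ _ Tx => z /KT[]. Qed.

(** Let s be the supremum of the points of [T] below [y]. If there are none, both sides vanish; if s
    is attained, neither side changes between s and [y]; otherwise points of [T] increase to s and
    both sides pass to the limit. *)
Lemma kernel_cdf x y : T x ->
  K x `]-oo, y]%classic = (power_mixture G x (distr_fun F y))%:E.
Proof.
move=> Tx; have x0 := T_gt0 Tx.
have KTE t : T t ->
    K x `]-oo, t]%classic = (power_mixture G x (distr_fun F t))%:E.
  move=> Tt; rewrite -power_mixtureE ?distr_fun_ge0 ?distr_fun_le1//.
  by have [_ ->] := KT Tx.
pose A := [set t | T t /\ t <= y].
have [A0|A0] := eqVneq A set0.
  have null (mu : {measure set (measurableTypeR R) -> \bar R}) :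
      mu (~` T) = 0%E -> mu `]-oo, y]%classic = 0%E.
    move=> muT; apply/eqP; rewrite eq_le measure_ge0 andbT -(measure0 mu).
    apply: (le_measure_null_compl mT _ _ muT) => // z [] /=; rewrite in_itv/=.
    by move=> zy Tz; have : A z by []; rewrite A0.
  by rewrite null ?KnT// /distr_fun null// power_mixture0.
have Ane : A !=set0 by exact/set0P.
have Aub : has_ubound A by exists y => t [].
pose s := sup A.
have sy : s <= y by apply: ge_sup => // t [].
have [As|nAs] := pselect (A s).
  have sE (mu : {measure set (measurableTypeR R) -> \bar R}) :
      mu (~` T) = 0%E -> mu `]-oo, y]%classic = mu `]-oo, s]%classic.
    move=> muT; apply/eqP; rewrite eq_le; apply/andP; split; last first.
      rewrite le_measure ?inE// => z /=; rewrite !in_itv/= => zs.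
      exact: le_trans zs sy.
    apply: (le_measure_null_compl mT _ _ muT) => //.
    by move=> z [] /=; rewrite !in_itv/= => zy Tz; exact: ub_le_sup.
  rewrite sE ?KnT// KTE; last by case: As.
  by rewrite /distr_fun (sE F).
have As t : T t -> t <= y -> t < s.
  move=> Tt ty; rewrite lt_neqAle; apply/andP; split.
    by apply: contra_not_neq nAs => <-.
  by apply: ub_le_sup.
have [u uP] : exists u : nat -> R, forall n, A (u n) /\ s - n.+1%:R^-1 < u n.
  have /choice : forall n : nat, exists t, A t /\ s - n.+1%:R^-1 < t.
    move=> n; have n0 : 0 < n.+1%:R^-1 :> R by rewrite invr_gt0.
    have [t At st] := sup_adherent n0 (conj Ane Aub).
    by exists t.
  by move=> [u uP]; exists u.
pose P : probability (measurableTypeR R) R :=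
  probability_of (prob_kernel x : K x setT = 1%E).
have PE B : P B = K x B by [].
have PnT : P (~` T) = 0%E by rewrite PE KnT.
have su n : s - n.+1%:R^-1 < u n by have [] := uP n.
have uy n : u n <= y by have [[]] := uP n.
have uT n : T (u n) by have [[]] := uP n.
have Kcvg := @distr_fun_cvg_support _ P T y s u mT PnT sy As su uy.
have Fcvg := @distr_fun_cvg_support _ F T y s u mT FnT sy As su uy.
have u01 n : 0 <= distr_fun F (u n) <= 1 by rewrite distr_fun_ge0 distr_fun_le1.
have Mcvg := @power_mixture_cvg _ G _ _ _ x0 u01 (distr_fun_ge0 F y)
  (distr_fun_le1 F y) Fcvg.
rewrite -PE -distr_funE; congr (_%:E).
have PFu : (fun n => distr_fun P (u n)) =
    (fun n => power_mixture G x (distr_fun F (u n))).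
  apply/funext => n; apply: EFin_inj; rewrite distr_funE PE; exact: KTE.
rewrite PFu in Kcvg.
exact: (cvg_unique _ Kcvg Mcvg).
Qed.

End mbpplre_kernel.

Section stieltjes.
Context {R : realType} (f : R -> R).
Hypotheses (f_nd : nondecreasing f) (f_rc : right_continuous f).

(** The hypotheses are made arguments so that the instance can refer to them. *)
Definition stieltjes_fun : R -> R := let _ := f_nd in let _ := f_rc in f.

HB.instance Definition _ := isCumulative.Build R _ R stieltjes_fun f_nd f_rc.

Lemma stieltjes_itv (a b : R) : a <= b ->
  lebesgue_stieltjes_measure stieltjes_fun `]a, b]%classic = (f b - f a)%:E.
Proof.
move=> ab; rewrite /lebesgue_stieltjes_measure /measure_extension/=.
by rewrite measurable_mu_extE/= ?wlength_itv_bnd//; exact: is_ocitv.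
Qed.

Lemma stieltjes_unique (mu : {measure set (measurableTypeR R) -> \bar R}) :
  (forall a b, a <= b -> mu `]a, b]%classic = (f b - f a)%:E) ->
  forall A, measurable A -> lebesgue_stieltjes_measure stieltjes_fun A = mu A.
Proof.
move=> muE; apply: lebesgue_stieltjes_measure_unique => _ [[a b] _ <-] /=.
have [ab|ba] := leP a b; first by rewrite stieltjes_itv// muE.
by rewrite set_itv_ge ?measure0// bnd_simp -leNgt ltW.
Qed.

End stieltjes.

Lemma power_mixture_gt0 {R : realType}
    (G : probability (measurableTypeR R) R) (c p : R) :
  G `]0, +oo[%classic = 1%E -> 0 < c -> 0 < p -> p <= 1 ->
  0 < power_mixture G c p.
Proof.
move=> G1 c0 p0 p1; rewrite lt0r power_mixture_ge0 andbT; apply/eqP => m0.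
have int := integrable_power_mixture G c0 (ltW p0) p1.
have mD : measurable (`]0, +oo[%classic : set (measurableTypeR R)).
  exact: measurable_itv.
have i0 : (\int[G]_(v in `]0%R, +oo[) `|(p `^ (c * v))%:E| = 0)%E.
  transitivity (\int[G]_(v in `]0%R, +oo[) (p `^ (c * v))%:E)%E.
    by apply: eq_integral => v _; rewrite gee0_abs// lee_fin powR_ge0.
  rewrite -(fineK (integrable_fin_num mD int)); congr (_%:E); exact: m0.
have := (ae_eq_integral_abs G mD (measurable_int G int)).1 i0.
move=> [N [mN N0 DN]].
have : (G `]0%R, +oo[%classic <= G N)%E.
  rewrite le_measure ?inE// => v Dv; apply: DN => /= /(_ Dv) /eqP.
  by rewrite eqe gt_eqF// powR_gt0.
by rewrite G1 N0 lee_fin ler10.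
Qed.

Section minorization.
Context {R : realType} (T : set (measurableTypeR R)).
Context (F G : probability (measurableTypeR R) R).
Context (K : R.-pker (measurableTypeR R) ~> (measurableTypeR R)).
Hypotheses (mT : measurable T) (T_pos : T `<=` `]0, +oo[%classic).
Hypotheses (F_T : F T = 1%E) (G_pos : G `]0, +oo[%classic = 1%E).
Hypothesis KT : MBPPLRE_kernel T F G K.

Let cdf c y := power_mixture G c (distr_fun F y).

Let cdf_nd c : 0 < c -> nondecreasing (cdf c).
Proof.
move=> c0 y z yz; apply: power_mixture_nondecreasing => //.
- exact: distr_fun_ge0.
- exact: distr_fun_nondecreasing.
- exact: distr_fun_le1.
Qed.

Let cdf_rc c : 0 < c -> right_continuous (cdf c).
Proof.
move=> c0 y; apply/cvg_at_rightP => u [uy uc].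
apply: power_mixture_cvg => //.
- by move=> n; rewrite distr_fun_ge0 distr_fun_le1.
- exact: distr_fun_ge0.
- exact: distr_fun_le1.
- by have /cvg_at_rightP := @distr_fun_right_continuous _ F y; apply.
Qed.

Let kernel_itv x y z : T x -> y <= z ->
  K x `]y, z]%classic = (cdf x z - cdf x y)%:E.
Proof.
move=> Tx yz.
have : K x `]-oo, z]%classic = (K x `]-oo, y]%classic + K x `]y, z]%classic)%E.
  rewrite -measureU//; first by congr (K x _); rewrite -itv_bndbnd_setU.
  rewrite -subset0 => t [] /=; rewrite !in_itv/= => ty /andP[/lt_le_trans].
  by move=> /(_ _ ty); rewrite ltxx.
rewrite !(kernel_cdf mT T_pos F_T G_pos KT)//.
case: (K x `]y, z]%classic) (measure_ge0 (K x) `]y, z]%classic) => [r|//|//] _.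
by rewrite -EFinD => -[]; rewrite /cdf => ->; congr (_%:E); lra.
Qed.

(** [kappa] and [lam] are the Stieltjes measures of [eta * cdf b] and [cdf x - eta * cdf b]. The
    latter function is nondecreasing because an increment of [cdf x] is at least [x / b >= eta]
    times that of [cdf b]. *)
Lemma kernel_minorization (b eta : R) : 0 < b -> 0 <= eta ->
  exists kappa : {measure set (measurableTypeR R) -> \bar R},
    (forall y z, y <= z -> kappa `]y, z]%classic =
      (eta * (power_mixture G b (distr_fun F z) -
              power_mixture G b (distr_fun F y)))%:E) /\
    forall x, T x -> x <= b -> eta * b <= x ->
      exists lam : {measure set (measurableTypeR R) -> \bar R},
        forall A, measurable A -> K x A = (kappa A + lam A)%E.
Proof.
move=> b0 eta0.
have nd0 : nondecreasing (fun y => eta * cdf b y).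
  by move=> y z yz; exact: (ler_wpM2l eta0 (cdf_nd b0 yz)).
have rc0 : right_continuous (fun y => eta * cdf b y).
  by move=> y; apply: cvgM; [exact: cvg_cst|exact: cdf_rc].
exists (lebesgue_stieltjes_measure (stieltjes_fun nd0 rc0)); split.
  by move=> y z yz; rewrite mulrBr; exact: stieltjes_itv.
move=> x Tx xb etax.
have x0 : 0 < x by have := T_pos Tx; rewrite /= in_itv/= andbT.
have nd1 : nondecreasing (fun y => cdf x y - eta * cdf b y).
  move=> y z yz.
  have H := power_mixture_ratio G x0 xb (distr_fun_ge0 F y)
    (distr_fun_nondecreasing F yz) (distr_fun_le1 F z).
  have c0 : 0 <= cdf b z - cdf b y by rewrite subr_ge0 cdf_nd.
  have : eta * b * (cdf b z - cdf b y) <= b * (cdf x z - cdf x y).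
    by apply: le_trans H; exact: (ler_wpM2r c0 etax).
  rewrite -mulrA mulrCA (ler_pM2l b0).
  move: (cdf b z) (cdf b y) (cdf x z) (cdf x y) => p q r s {H c0}; lra.
have rc1 : right_continuous (fun y => cdf x y - eta * cdf b y).
  by move=> y; apply: cvgB; [exact: cdf_rc|exact: rc0].
exists (lebesgue_stieltjes_measure (stieltjes_fun nd1 rc1)) => A mA.
rewrite -(stieltjes_unique (cdf_nd x0) (cdf_rc x0) (mu := K x))//; last first.
  by move=> y z yz; exact: kernel_itv.
set k := lebesgue_stieltjes_measure (stieltjes_fun nd0 rc0).
set l := lebesgue_stieltjes_measure (stieltjes_fun nd1 rc1).
have klE y z : y <= z ->
    measure_add k l `]y, z]%classic = (cdf x z - cdf x y)%:E.
  move=> yz; rewrite measure_addE.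
  transitivity ((eta * cdf b z - eta * cdf b y)%:E +
      ((cdf x z - eta * cdf b z) - (cdf x y - eta * cdf b y))%:E)%E.
    by congr (_ + _)%E; exact: stieltjes_itv.
  rewrite -EFinD; congr (_%:E).
  by move: (cdf b z) (cdf b y) (cdf x z) (cdf x y) => p q r s; ring.
rewrite (stieltjes_unique (cdf_nd x0) (cdf_rc x0) klE mA).
exact: measure_addE.
Qed.

End minorization.

(** * The Lyapunov function of the chain *)

Section product_projections.
Context d1 d2 (X1 : measurableType d1) (X2 : measurableType d2) (R : realType).
Context (m1 : probability X1 R) (m2 : probability X2 R).

Lemma integrable_fst (f : X1 -> R) : m1.-integrable setT (EFin \o f) ->
  (m1 \x m2)%E.-integrable setT (EFin \o (f \o fst)).
Proof.
move=> intf; have mf := measurable_int m1 intf.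
have mff : measurable_fun setT (EFin \o (f \o fst) : X1 * X2 -> \bar R).
  by rewrite compA; apply: (measurableT_comp mf).
apply/(integrable12ltyP m1 m2 mff) => /=.
have /integrableP[_] := intf.
congr (_ < _)%E; apply: eq_integral => x _ /=.
by rewrite integral_cst// [X in (_ * X)%E](probability_setT m2) mule1.
Qed.

Lemma integral_fst (f : X1 -> R) : m1.-integrable setT (EFin \o f) ->
  (\int[m1 \x m2]_z (f z.1)%:E = \int[m1]_x (f x)%:E)%E.
Proof.
move=> intf; have := integral12_prod_meas1 (integrable_fst intf).
rewrite /fubini_F /= => <-; apply: eq_integral => x _ /=.
by rewrite integral_cst// [X in (_ * X)%E](probability_setT m2) mule1.
Qed.

Lemma integrable_snd (f : X2 -> R) : m2.-integrable setT (EFin \o f) ->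
  (m1 \x m2)%E.-integrable setT (EFin \o (f \o snd)).
Proof.
move=> intf; have mf := measurable_int m2 intf.
have mff : measurable_fun setT (EFin \o (f \o snd) : X1 * X2 -> \bar R).
  by rewrite compA; apply: (measurableT_comp mf).
apply/(integrable21ltyP m1 m2 mff) => /=.
have /integrableP[_] := intf.
congr (_ < _)%E; apply: eq_integral => x _ /=.
by rewrite integral_cst// [X in (_ * X)%E](probability_setT m1) mule1.
Qed.

Lemma integral_snd (f : X2 -> R) : m2.-integrable setT (EFin \o f) ->
  (\int[m1 \x m2]_z (f z.2)%:E = \int[m2]_x (f x)%:E)%E.
Proof.
move=> intf; have := integral21_prod_meas1 (integrable_snd intf).
rewrite /fubini_G /= => <-; apply: eq_integral => x _ /=.
by rewrite integral_cst// [X in (_ * X)%E](probability_setT m1) mule1.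
Qed.

End product_projections.

Section log_increment.
Context {R : realType} (G : probability (measurableTypeR R) R).

(* Conditionally on [nu = z.1], the variable [ln nu + gumbel] has distribution
   function [exp (- nu exp (- t))]. *)
Definition log_increment (z : measurableTypeR R * measurableTypeR R) : R :=
  ln z.1 + gumbel z.2.

Lemma measurable_log_increment : measurable_fun setT log_increment.
Proof.
apply: measurable_funD.
- exact: (measurableT_comp (@measurable_ln R)).
- exact: (measurableT_comp (@measurable_gumbel R)).
Qed.

Hypothesis int_ln : G.-integrable setT (EFin \o (@ln R)).

Lemma integrable_log_increment :
  (G \x unif)%E.-integrable setT (EFin \o log_increment).
Proof.
have -> : EFin \o log_increment =
    ((EFin \o (@ln R \o fst)) \+ (EFin \o (gumbel \o snd)))%E by [].
apply: integrableD => //.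
- exact: integrable_fst.
- apply: integrable_snd; exact: integrable_gumbel.
Qed.

Lemma integral_log_increment m : (\int[G]_v (ln v)%:E = m%:E)%E ->
  (\int[G \x unif]_z (log_increment z)%:E = (m + euler_gamma R)%:E)%E.
Proof.
move=> mE.
rewrite (_ : (fun z => _) =
    ((EFin \o (@ln R \o fst)) \+ (EFin \o (gumbel \o snd)))%E)//.
rewrite integralD//; last 2 first.
- exact: integrable_fst.
- apply: integrable_snd; exact: integrable_gumbel.
rewrite /= integral_fst// integral_snd//; last exact: integrable_gumbel.
rewrite mE EFinD euler_gamma_gumbel /Rintegral fineK//.
apply: integrable_fin_num => //; exact: integrable_gumbel.
Qed.

End log_increment.

Section limit_bounds.
Context {R : realType}.

Lemma lt_expR_eps (s : \bar R) (l : R) : (s < (expR l)%:E)%E ->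
  exists2 e, 0 < e & (s <= (expR (l - e))%:E)%E.
Proof.
case: s => [s| |]; [|by rewrite ltNge leey|by exists 1 => //; rewrite leNye].
(* The maximum keeps the argument of the logarithm positive when [s] is not. *)
rewrite lte_fin => sl; pose m := Num.max s (expR l / 2).
have m0 : 0 < m by rewrite lt_max divr_gt0 ?expR_gt0// orbT.
exists (l - ln m).
  rewrite subr_gt0 -[X in _ < X](expRK l) ltr_ln ?posrE ?expR_gt0//.
  by rewrite gt_max sl ltr_pdivrMr// ltr_pMr ?expR_gt0// ltr1n.
by rewrite subKr lnK ?posrE// lee_fin le_max lexx.
Qed.

Lemma gt_expR_eps (s : \bar R) (l : R) : ((expR l)%:E < s)%E ->
  exists2 e, 0 < e & ((expR (l + e))%:E <= s)%E.
Proof.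
case: s => [s| |]; [|by exists 1 => //; rewrite leey|by rewrite ltNge leNye].
rewrite lte_fin => sl; have s0 : 0 < s := lt_trans (expR_gt0 _) sl.
exists (ln s - l).
  by rewrite subr_gt0 -[X in X < _](expRK l) ltr_ln ?posrE ?expR_gt0.
by rewrite addrC subrK lnK ?posrE.
Qed.

Lemma neg_log_le (p q y : R) : 0 < y ->
  (y%:E * neg_log p <= q%:E)%E -> expR (- (q / y)) <= p.
Proof.
move=> y0; rewrite /neg_log; have [p0|p0] := leP p 0.
  (* Here [neg_log p] is infinite, against the finite bound. *)
  by rewrite le0_lneNy ?lee_fin//= mulry gtr0_sg// mul1e.
rewrite lne_EFin// -EFinN -EFinM lee_fin => H.
rewrite -[leRHS]lnK ?posrE// ler_expR lerNl ler_pdivlMr// mulrC.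
exact: H.
Qed.

Lemma neg_log_ge (p q y : R) : 0 < y -> 0 <= p ->
  (q%:E <= y%:E * neg_log p)%E -> p <= expR (- (q / y)).
Proof.
move=> y0; rewrite /neg_log le_eqVlt => /predU1P[<-|p0].
  by move=> _; exact: expR_ge0.
rewrite lne_EFin// -EFinN -EFinM lee_fin => H.
rewrite -[leLHS]lnK ?posrE// ler_expR lerNr ler_pdivrMr// mulrC.
exact: H.
Qed.

Context (F : probability (measurableTypeR R) R) (delta : R).

(** Near infinity F lies above a Frechet distribution function; the strict inequality leaves the
    margin [e] in the exponent. *)
Lemma limsup_distr_fun :
  (limf_esup (fun x : R => x%:E * neg_log (distr_fun F x)) (pinfty_nbhs R)
      < (expR (- delta))%:E)%E ->
  exists2 e : R, 0 < e & exists2 a : R, 0 < a & forall y, a < y ->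
    expR (- (expR (- delta - e) / y)) <= distr_fun F y.
Proof.
rewrite limf_esupE => /ereal_inf_lt[_ [V [a [ar aV]] <-]] /lt_expR_eps[e e0 Ve].
(* The 1 guarantees [y > 0]. *)
exists e => //; exists (Num.max 1 a); first by rewrite lt_max ltr01.
move=> y; rewrite gt_max => /andP[y1 ay].
apply: neg_log_le; first exact: lt_trans y1.
by apply: le_trans Ve; apply: ereal_sup_ubound; exists y => //; exact: aV.
Qed.

Lemma liminf_distr_fun :
  (limf_einf (fun x : R => x%:E * neg_log (distr_fun F x)) (0 : R)^'+
      > (expR (- delta))%:E)%E ->
  exists2 e : R, 0 < e & exists2 a : R, 0 < a & forall y, 0 < y -> y < a ->
    distr_fun F y <= expR (- (expR (- delta + e) / y)).
Proof.
rewrite limf_einfE => /ereal_sup_gt[_ [V [a /= a0 aV] <-]] /gt_expR_eps[e e0 Ve].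
exists e => //; exists a => // y y0 ya.
apply: neg_log_ge => //; first exact: distr_fun_ge0.
apply: (le_trans Ve); apply: ereal_inf_lbound; exists y => //.
by apply: aV => //=; rewrite sub0r normrN gtr0_norm.
Qed.

End limit_bounds.

Section tails.
Context {R : realType} (T : set (measurableTypeR R)).
Context (F G : probability (measurableTypeR R) R).
Context (K : R.-pker (measurableTypeR R) ~> (measurableTypeR R)).
Hypotheses (mT : measurable T) (T_pos : T `<=` `]0, +oo[%classic).
Hypotheses (F_T : F T = 1%E) (G_pos : G `]0, +oo[%classic = 1%E).
Hypothesis KT : MBPPLRE_kernel T F G K.

Let D : set (measurableTypeR R) := `]0, +oo[%classic.

Let mD : measurable D. Proof. exact: measurable_itv. Qed.

Let Q : probability (measurableTypeR R * measurableTypeR R)%type R :=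
  (G \x unif)%E.

Let GnD : G (~` D) = 0%E.
Proof. by apply/probability_null_compl. Qed.

Let product_slices (A : set (measurableTypeR R * measurableTypeR R)) :
  measurable A -> Q A = (\int[G]_(v in D) unif (xsection A v))%E.
Proof.
move=> mA; apply/esym/integral_null_compl => //.
exact: measurable_fun_xsection.
Qed.

Let measurable_slices (A : set (measurableTypeR R * measurableTypeR R)) :
  measurable A -> measurable_fun D (fun v => unif (xsection A v)).
Proof. by move=> mA; apply: measurable_funTS; exact: measurable_fun_xsection. Qed.

Let measurable_gt (f : measurableTypeR R * measurableTypeR R -> R) (t : R) :
  measurable_fun setT f -> measurable [set z | t < f z].
Proof.
move=> mf; have := mf measurableT _ (measurable_itv `]t, +oo[).
rewrite setTI; congr measurable.
by apply/seteqP; split => z /=; rewrite in_itv/= andbT.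
Qed.

Let power_mixture_int x p : 0 < x -> 0 <= p -> p <= 1 ->
  (power_mixture G x p)%:E = (\int[G]_(v in D) (p `^ (x * v))%:E)%E.
Proof.
move=> x0 p0 p1; rewrite /power_mixture /Rintegral fineK//.
by apply: integrable_fin_num => //; exact: integrable_power_mixture.
Qed.

Let expR_powR (r e : R) : expR r `^ e = expR (r * e).
Proof. by rewrite /powR gt_eqF ?expR_gt0// expRK mulrC. Qed.

(** Given [nu = v], the Frechet law with parameter q yields [1 - exp (- x q v / exp t)] on both
    sides. A larger value of F at [exp t] only lowers the left-hand side. *)
Lemma kernel_tail_right (x q t : R) : T x -> 0 < q -> 0 <= t ->
  expR (- (q / expR t)) <= distr_fun F (expR t) ->
  (K x [set z | (t < ln z)%R] <=
   Q [set z | (t < ln x + (ln q + log_increment z))%R])%E.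
Proof.
move=> Tx q0 t0 Fq.
have x0 : 0 < x by have := T_pos Tx; rewrite /= in_itv/= andbT.
set p := distr_fun F (expR t).
have p0 : 0 <= p := distr_fun_ge0 _ _.
have p1 : p <= 1 := distr_fun_le1 _ _.
set A := [set z | _ < _ + _].
have mA : measurable A.
  apply: measurable_gt; apply: measurable_funD => //.
  by apply: measurable_funD => //; exact: measurable_log_increment.
(* As [0 <= t] and [ln] vanishes on nonpositive reals, the event contains positive z only. *)
have -> : [set z | t < ln z] = ~` `]-oo, expR t]%classic.
  apply/seteqP; split => z /=; rewrite in_itv/= => tz.
    apply/negP; rewrite -ltNge.
    have z0 : 0 < z.
      by rewrite ltNge; apply/negP => z0; move: tz; rewrite ln0// ltNge t0.
    by rewrite -ltr_ln ?posrE ?expR_gt0// expRK.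
  move/negP: tz; rewrite -ltNge => tz.
  by rewrite -ltr_expR lnK// posrE (lt_trans _ tz)// expR_gt0.
have KxC : K x (~` `]-oo, expR t]%classic) = (1 - (power_mixture G x p)%:E)%E.
  pose P : probability (measurableTypeR R) R :=
    probability_of (prob_kernel (x : measurableTypeR R) : K x setT = 1%E).
  rewrite -(kernel_cdf mT T_pos F_T G_pos KT (expR t) Tx).
  by apply: (@probability_setC _ _ _ P); exact: measurable_itv.
rewrite KxC leeBlDl// product_slices// power_mixture_int//.
have -> : (1 = \int[G]_(v in D) cst 1 v :> \bar R)%E.
  by rewrite integral_cst// [X in (_ * X)%E]G_pos mule1.
have mp : measurable_fun D (fun v => (p `^ (x * v))%:E).
  exact: (measurable_int G (integrable_power_mixture G x0 p0 p1)).
rewrite -ge0_integralD//; last 2 first.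
- by move=> v _; rewrite lee_fin powR_ge0.
- exact: measurable_slices.
apply: ge0_le_integral => //.
- by apply: emeasurable_funD => //; exact: measurable_slices.
move=> v; rewrite /D /= in_itv/= andbT => v0.
have -> : xsection A v = [set u | t - ln x - ln q - ln v < gumbel u].
  apply/seteqP; split => u; rewrite /xsection /= /A inE /= /log_increment /=; lra.
have U := unif_gumbel_gt (t - ln x - ln q - ln v).
apply: le_trans (leeD (lexx _) U).
rewrite -EFinD lee_fin.
have E1 : expR (- (t - ln x - ln q - ln v)) = x * q * v / expR t.
  have -> : - (t - ln x - ln q - ln v) = ln (x * q * v) - t.
    by rewrite !lnM ?posrE ?mulr_gt0//; ring.
  by rewrite expRD expRN lnK// posrE !mulr_gt0.
have E2 : expR (- (q / expR t)) `^ (x * v) <= p `^ (x * v).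
  by apply: ge0_ler_powR; rewrite ?nnegrE ?expR_ge0// mulr_ge0// ltW.
have E3 : expR (- (q / expR t)) `^ (x * v) = expR (- (x * q * v / expR t)).
  by rewrite expR_powR; congr expR; ring.
rewrite E1 -E3; move: E2.
move: (expR (- (q / expR t)) `^ (x * v)) (p `^ (x * v)) => a b; lra.
Qed.

(** Mirror image of the right tail: a smaller value of F at [exp (- t)] lowers the left-hand side.
    The event is enlarged to a closed half-line, where the kernel is explicit. *)
Lemma kernel_tail_left (x q t : R) : T x -> 0 < q -> 0 <= t ->
  distr_fun F (expR (- t)) <= expR (- (q / expR (- t))) ->
  (K x [set z | (t < - ln z)%R] <=
   Q [set z | (t < - ln x + - (ln q + log_increment z))%R])%E.
Proof.
move=> Tx q0 t0 Fq.
have x0 : 0 < x by have := T_pos Tx; rewrite /= in_itv/= andbT.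
set p := distr_fun F (expR (- t)).
have p0 : 0 <= p := distr_fun_ge0 _ _.
have p1 : p <= 1 := distr_fun_le1 _ _.
set A := [set z | _ < _ + _].
have mA : measurable A.
  apply: measurable_gt; apply: measurable_funD => //; apply: measurable_funN.
  by apply: measurable_funD => //; exact: measurable_log_increment.
have mS : measurable [set z : measurableTypeR R | t < - ln z].
  have mln : measurable_fun [set: measurableTypeR R] (fun z : R => - ln z).
    by apply: measurable_funN; exact: measurable_ln.
  have := mln measurableT _ (measurable_itv `]t, +oo[).
  rewrite setTI; congr measurable.
  by apply/seteqP; split => z /=; rewrite in_itv/= andbT.
apply: (@le_trans _ _ (K x `]-oo, expR (- t)]%classic)).
  apply: le_measure; rewrite ?inE//.
  move=> z /=; rewrite in_itv/= ltrNr => tz.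
  have [z0|z0] := leP z 0; first exact: le_trans (expR_ge0 _).
  by rewrite -ler_ln ?posrE ?expR_gt0// expRK ltW.
rewrite (kernel_cdf mT T_pos F_T G_pos KT (expR (- t)) Tx).
rewrite product_slices// power_mixture_int//.
have mp : measurable_fun D (fun v => (p `^ (x * v))%:E).
  exact: (measurable_int G (integrable_power_mixture G x0 p0 p1)).
apply: ge0_le_integral => //.
- by move=> v _; rewrite lee_fin powR_ge0.
- exact: measurable_slices.
move=> v; rewrite /D /= in_itv/= andbT => v0.
have -> : xsection A v = [set u | t + ln x + ln q + ln v < - gumbel u].
  apply/seteqP; split => u; rewrite /xsection /= /A inE /= /log_increment /=; lra.
apply: le_trans (unif_gumbel_lt (t + ln x + ln q + ln v)).
rewrite lee_fin.
have E1 : expR (t + ln x + ln q + ln v) = x * q * v / expR (- t).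
  have -> : t + ln x + ln q + ln v = ln (x * q * v) - (- t).
    by rewrite !lnM ?posrE ?mulr_gt0//; ring.
  by rewrite expRD expRN lnK// posrE !mulr_gt0.
have -> : expR (- expR (t + ln x + ln q + ln v)) =
    expR (- (q / expR (- t))) `^ (x * v).
  by rewrite E1 expR_powR; congr expR; ring.
by apply: ge0_ler_powR; rewrite ?nnegrE ?expR_ge0// mulr_ge0// ltW.
Qed.

End tails.

Section ergodicity.
Context {R : realType} (T : set (measurableTypeR R)).
Context (F G : probability (measurableTypeR R) R).
Context (K : R.-pker (measurableTypeR R) ~> (measurableTypeR R)).
Hypotheses (mT : measurable T) (T_pos : T `<=` `]0, +oo[%classic).
Hypotheses (F_T : F T = 1%E) (G_pos : G `]0, +oo[%classic = 1%E).
Hypothesis KT : MBPPLRE_kernel T F G K.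
Context (m delta : R).
Hypothesis int_ln : G.-integrable setT (EFin \o (@ln R)).
Hypothesis mean_ln : (\int[G]_v (ln v)%:E = m%:E)%E.
Hypothesis delta_def : delta = euler_gamma R + m.

Let Q : probability (measurableTypeR R * measurableTypeR R)%type R :=
  (G \x unif)%E.

(** [xi_right] and [xi_left] are the increments of [ln Z] and [- ln Z] for the two comparison laws;
    both have mean [- e]. *)
Let xi_right e (z : measurableTypeR R * measurableTypeR R) : R :=
  ln (expR (- delta - e)) + log_increment z.

Let xi_left e (z : measurableTypeR R * measurableTypeR R) : R :=
  - (ln (expR (- delta + e)) + log_increment z).

Let int_log : Q.-integrable setT (EFin \o @log_increment R).
Proof. exact: integrable_log_increment. Qed.

Let int_cst (r : R) : Q.-integrable setT (EFin \o cst r).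
Proof. exact: finite_measure_integrable_cst. Qed.

Let integral_cstQ (r : R) : (\int[Q]_z (cst r z)%:E = r%:E)%E.
Proof.
transitivity (\int[Q]_z cst r%:E z)%E; first by [].
by rewrite integral_cst// [X in (_ * X)%E](probability_setT Q) mule1.
Qed.

Let int_add (r : R) :
  Q.-integrable setT (EFin \o (fun z => r + log_increment z)).
Proof.
have -> : EFin \o (fun z => r + log_increment z) =
  ((EFin \o cst r) \+ (EFin \o @log_increment R))%E by [].
exact: integrableD.
Qed.

Let integral_add (r : R) :
  (\int[Q]_z (r + log_increment z)%:E = (r + delta)%:E)%E.
Proof.
have -> : (fun z => (r + log_increment z)%:E) =
  ((EFin \o cst r) \+ (EFin \o @log_increment R))%E by [].
rewrite integralD// [X in (X + _)%E]integral_cstQ.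
by rewrite (integral_log_increment int_ln mean_ln) -EFinD delta_def (addrC m).
Qed.

Let int_right e : Q.-integrable setT (EFin \o xi_right e).
Proof. exact: int_add. Qed.

Let integral_right e : (\int[Q]_z (xi_right e z)%:E = (- e)%:E)%E.
Proof. by rewrite integral_add expRK; congr (_%:E); ring. Qed.

Let int_left e : Q.-integrable setT (EFin \o xi_left e).
Proof.
have -> : EFin \o xi_left e =
  (\- (EFin \o
     (fun z => (ln (expR (- delta + e)) + log_increment z)%R)))%E by [].
exact: integrableN.
Qed.

Let integral_left e : (\int[Q]_z (xi_left e z)%:E = (- e)%:E)%E.
Proof.
have -> : (fun z => (xi_left e z)%:E) =
  (\- (EFin \o
     (fun z => (ln (expR (- delta + e)) + log_increment z)%R)))%E by [].
rewrite integralN//; last exact/integrable_add_def/int_add.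
by rewrite integral_add expRK -EFinN; congr (_%:E); ring.
Qed.

Definition log_lyapunov (L a x : R) : R :=
  huber L (ln x - a) + huber L (- ln x - a).

Lemma measurable_log_lyapunov L a :
  measurable_fun [set: measurableTypeR R] (log_lyapunov L a).
Proof.
apply: measurable_funD.
- apply: (measurableT_comp (@measurable_huber R L)).
  by apply: measurable_funB => //; exact: measurable_ln.
- apply: (measurableT_comp (@measurable_huber R L)).
  by apply: measurable_funB => //; apply: measurable_funN; exact: measurable_ln.
Qed.

(** The two terms of the function are treated separately, the first by the behaviour of F near
    infinity and the second by that near 0. *)
Lemma log_lyapunov_drift (e a L : R) (x : measurableTypeR R) :
  0 < L -> 0 <= a ->
  (forall t, a <= t ->
    expR (- (expR (- delta - e) / expR t)) <= distr_fun F (expR t)) ->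
  (forall t, a <= t ->
    distr_fun F (expR (- t)) <= expR (- (expR (- delta + e) / expR (- t)))) ->
  T x ->
  (\int[K x]_z (log_lyapunov L a z)%:E <=
   (log_lyapunov L a x -
     e * (huber_slope L (ln x - a) + huber_slope L (- ln x - a)))%:E +
   (huber_remainder Q (xi_right e) L + huber_remainder Q (xi_left e) L))%E.
Proof.
move=> L0 a0 Fr Fl Tx.
pose P : probability (measurableTypeR R) R :=
  probability_of (prob_kernel x : K x setT = 1%E).
have mln : measurable_fun [set: measurableTypeR R] (@ln R) by exact: measurable_ln.
have mNln : measurable_fun [set: measurableTypeR R] (fun z : R => - ln z).
  exact: measurable_funN.
have r := @huber_drift _ _ _ _ R P Q (@ln R) (xi_right e) mln (int_right e)
  L a (ln x) (- e) L0 (integral_right e).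
have l := @huber_drift _ _ _ _ R P Q (fun z : R => - ln z) (xi_left e) mNln
  (int_left e) L a (- ln x) (- e) L0 (integral_left e).
have {}r := r (fun t at_ => kernel_tail_right mT T_pos F_T G_pos KT Tx
  (expR_gt0 _) (le_trans a0 at_) (Fr t at_)).
have {}l := l (fun t at_ => kernel_tail_left mT T_pos F_T G_pos KT Tx
  (expR_gt0 _) (le_trans a0 at_) (Fl t at_)).
have mh (f : measurableTypeR R -> R) : measurable_fun setT f ->
    measurable_fun setT (fun z => (huber L (f z - a))%:E).
  move=> mf; apply/measurable_EFinP.
  apply: (measurableT_comp (@measurable_huber R L)).
  exact: measurable_funB.
have -> : (\int[K x]_z (log_lyapunov L a z)%:E =
    \int[P]_z (huber L (ln z - a))%:E + \int[P]_z (huber L (- ln z - a))%:E)%E.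
  rewrite -ge0_integralD//.
  - by move=> z _; rewrite lee_fin huber_ge0.
  - exact: mh.
  - by move=> z _; rewrite lee_fin huber_ge0.
  - exact: mh.
apply: (le_trans (leeD r l)); rewrite addeACA -EFinD; apply: leeD => //.
rewrite lee_fin /log_lyapunov le_eqVlt; apply/orP; left; apply/eqP.
move: (huber L _) (huber L _) (huber_slope L _) (huber_slope L _) => h1 h2 s1 s2.
by ring.
Qed.

(** With [eps = e / 3] and L so large that each remainder is below [e / 6], the mean increases by at
    most [eps]. Where a slope equals 1 the linear term contributes [- e], hence a total of at most
    [- e + e / 3 = - 2 * eps]. *)
Lemma exists_log_lyapunov :
  (limf_esup (fun x : R => x%:E * neg_log (distr_fun F x)) (pinfty_nbhs R)
     < (expR (- delta))%:E)%E ->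
  (limf_einf (fun x : R => x%:E * neg_log (distr_fun F x)) (0 : R)^'+
     > (expR (- delta))%:E)%E ->
  exists L a eps : R, [/\ 0 < L, 0 <= a, 0 < eps,
    forall x, T x -> (\int[K x]_z (log_lyapunov L a z)%:E <=
                      (log_lyapunov L a x + eps)%:E)%E
  & forall x, T x -> a + L <= `|ln x| ->
      (\int[K x]_z (log_lyapunov L a z)%:E <=
       (log_lyapunov L a x - 2 * eps)%:E)%E].
Proof.
move=> /limsup_distr_fun[e1 e1_gt0 [a1 a1_gt0 Fr]].
move=> /liminf_distr_fun[e2 e2_gt0 [a2 a2_gt0 Fl]].
pose e := Num.min e1 e2.
have e0 : 0 < e by rewrite lt_min e1_gt0.
have ee1 : e <= e1 by rewrite ge_min lexx.
have ee2 : e <= e2 by rewrite ge_min lexx orbT.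
(* Then [exp a] exceeds [a1] and [exp (- a)] is below [a2]. *)
have [a [a0 ea1 ea2]] : exists a, [/\ 0 <= a, ln a1 < a & - ln a2 < a].
  exists (1 + `|ln a1| + `|ln a2|).
  have := ler_norm (ln a1); have := ler_norm (- ln a2); rewrite normrN.
  have := normr_ge0 (ln a1); have := normr_ge0 (ln a2).
  by move: `|ln a1| `|ln a2| => u v *; split; lra.
have Fr' t : a <= t ->
    expR (- (expR (- delta - e) / expR t)) <= distr_fun F (expR t).
  move=> at_; apply: le_trans (Fr _ _); last first.
    by rewrite -[X in X < _]lnK ?posrE// ltr_expR (lt_le_trans ea1).
  by rewrite ler_expR lerN2 ler_pM2r ?invr_gt0 ?expR_gt0// ler_expR lerD2l lerN2.
have Fl' t : a <= t ->
    distr_fun F (expR (- t)) <= expR (- (expR (- delta + e) / expR (- t))).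
  move=> at_; apply: (le_trans (Fl _ (expR_gt0 _) _)).
    by rewrite -[X in _ < X]lnK ?posrE// ltr_expR ltrNl (lt_le_trans ea2).
  by rewrite ler_expR lerN2 ler_pM2r ?invr_gt0 ?expR_gt0// ler_expR lerD2l.
have rem (xi : measurableTypeR R * measurableTypeR R -> R) :
    Q.-integrable setT (EFin \o xi) ->
    \forall n \near \oo, (huber_remainder Q xi n.+1%:R < (e / 6)%:E)%E.
  move=> int_xi.
  have := @huber_remainder_cvg0 _ _ R Q xi int_xi.
  move=> /fine_cvgP[rfin /cvgr0Pnorm_lt rc].
  have e6 : 0 < e / 6 by rewrite divr_gt0.
  have := rc _ e6; apply: filterS2 rfin => n rfin.
  by rewrite /= -{2}(fineK rfin) lte_fin => /(le_lt_trans (ler_norm _)).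
have [n _ /(_ n (leqnn n)) [rr rl]] :=
  filterI (rem _ (int_right e)) (rem _ (int_left e)).
pose L : R := n.+1%:R.
have L0 : 0 < L by [].
exists L, a, (e / 3); split => //; first by rewrite divr_gt0.
  move=> x Tx; apply: (le_trans (log_lyapunov_drift L0 a0 Fr' Fl' Tx)).
  apply: (le_trans (leeD (lexx _) (leeD (ltW rr) (ltW rl)))).
  rewrite -!EFinD lee_fin.
  have s1 := huber_slope_ge0 (ln x - a) L0.
  have s2 := huber_slope_ge0 (- ln x - a) L0.
  have : 0 <= e * (huber_slope L (ln x - a) + huber_slope L (- ln x - a)).
    by rewrite mulr_ge0 ?addr_ge0// ltW.
  lra.
move=> x Tx xL; apply: (le_trans (log_lyapunov_drift L0 a0 Fr' Fl' Tx)).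
apply: (le_trans (leeD (lexx _) (leeD (ltW rr) (ltW rl)))).
rewrite -!EFinD lee_fin.
have s1 := huber_slope_ge0 (ln x - a) L0.
have s2 := huber_slope_ge0 (- ln x - a) L0.
(* One of [ln x - a] and [- ln x - a] is at least L, where the slope has reached 1. *)
have : 1 <= huber_slope L (ln x - a) + huber_slope L (- ln x - a).
  have [lx|lx] := leP 0 (ln x).
    by rewrite huber_slope_ge ?lerDl//; move: xL; rewrite ger0_norm//; lra.
  by rewrite [X in _ + X]huber_slope_ge ?lerDr//; move: xL; rewrite ltr0_norm//; lra.
move=> /(ler_wpM2l (ltW e0)); rewrite mulr1; lra.
Qed.

Lemma mbpplre_ergodic :
  (limf_esup (fun x : R => x%:E * neg_log (distr_fun F x)) (pinfty_nbhs R)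
     < (expR (- delta))%:E)%E ->
  (limf_einf (fun x : R => x%:E * neg_log (distr_fun F x)) (0 : R)^'+
     > (expR (- delta))%:E)%E ->
  ergodic_on T K.
Proof.
move=> Fsup Finf.
have [L [a [eps [L0 a0 eps0 drift drift_out]]]] := exists_log_lyapunov Fsup Finf.
have [x0 Tx0] : T !=set0.
  apply/set0P/eqP => T0; move: F_T; rewrite T0 measure0 => /eqP.
  by rewrite eq_sym onee_eq0.
have T_gt0 x : T x -> 0 < x by move=> /T_pos /=; rewrite in_itv/= andbT.
(* The last term puts [x0] into [C], which must be nonempty. *)
pose A := a + L + `|ln x0|.
have A0 : 0 <= A by rewrite !addr_ge0// ltW.
pose C : set (measurableTypeR R) := T `&` `[expR (- A), expR A]%classic.
have mC : measurable C by apply: measurableI => //; exact: measurable_itv.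
have CT : C `<=` T by move=> x [].
have inC x : T x -> `|ln x| <= A -> C x.
  move=> Tx; rewrite ler_norml => /andP[Al lA]; split => //=.
  have x_gt0 := T_gt0 _ Tx.
  by rewrite in_itv/= -[X in _ <= X <= _]lnK ?posrE// !ler_expR Al.
have Cx0 : C x0 by apply: inC => //; rewrite lerDr addr_ge0// ltW.
have b0 : 0 < expR A := expR_gt0 _.
(* With [b = exp A] and [eta = exp (- 2 A)], the range [[eta * b, b]] is exactly the interval
   defining [C]. *)
have eta0 : 0 <= expR (- A - A) := expR_ge0 _.
have [kappa [kappaE minor]] := kernel_minorization mT T_pos F_T G_pos KT b0 eta0.
have minorC x : C x -> exists lam : {measure set (measurableTypeR R) -> \bar R},
    forall B, measurable B -> K x B = (kappa B + lam B)%E.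
  move=> [Tx /=]; rewrite in_itv/= => /andP[Ax xA]; apply: minor => //.
  by rewrite -expRD subrK.
have kappa1 : (kappa setT <= 1)%E.
  have [lam lamE] := minorC _ Cx0.
  rewrite -(prob_kernel (x0 : measurableTypeR R) : K x0 setT = 1%E).
  by rewrite lamE// leeDl.
pose kap : giry (measurableTypeR R) R := subprobability_of kappa1.
(* The limsup bound makes F positive at large points while F vanishes at 0, so [kappa] charges some
   interval ]0, y]. *)
have kap_gt0 : (0 < kap setT)%E.
  have [e _ [y0 y0_gt0 Fy]] := limsup_distr_fun Fsup.
  pose y := y0 + 1.
  have Fy0 : 0 < distr_fun F y.
    by apply: lt_le_trans (Fy y _); rewrite ?expR_gt0// ltrDl.
  have F0 : distr_fun F 0 = 0.
    apply: EFin_inj; rewrite distr_funE; apply/eqP.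
    rewrite eq_le measure_ge0 andbT.
    have FnT : F (~` T) = 0%E by apply/probability_null_compl.
    apply: (@le_trans _ _ (F (~` T))); last by rewrite FnT.
    apply: le_measure; rewrite ?inE//; first exact: measurableC.
    by move=> z /=; rewrite in_itv/= leNgt => /negP z0 /T_gt0.
  have : (0 < kappa `]0%R, y]%classic)%E.
    rewrite kappaE ?addr_ge0 ?ltW// lte_fin mulr_gt0 ?expR_gt0// F0.
    rewrite power_mixture0// subr0; apply: power_mixture_gt0 => //.
    exact: distr_fun_le1.
  by move=> /lt_le_trans; apply; apply: le_measure; rewrite ?inE//;
    exact: measurable_itv.
apply: (ergodic_on_of_kernel_iter mT).
apply: (@drift_minorization_ergodic _ _ R K T C kap (log_lyapunov L a) eps) => //.
- by exists x0.
- by move=> x Tx; have [] := KT Tx.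
- by move=> x; rewrite addr_ge0// huber_ge0.
- exact: measurable_log_lyapunov.
- move=> x Tx nCx; apply: drift_out => //.
  rewrite leNgt; apply/negP => xA; apply: nCx; apply: inC => //.
  by rewrite (le_trans (ltW xA))// lerDl.
Qed.

End ergodicity.

Theorem theorem1 (R : realType)
  (T : set (measurableTypeR R))
  (mT : measurable T)
  (T_pos : T `<=` `]0, +oo[%classic)
  (F : probability (measurableTypeR R) R)
  (F_T : F T = 1%E)
  (G : probability (measurableTypeR R) R)
  (G_pos : G `]0, +oo[%classic = 1%E)
  (d : measure_display) (Omega : measurableType d) (P : probability Omega R)
  (nu : {mfun Omega >-> measurableTypeR R})
  (nu_G : forall A : set (measurableTypeR R), measurable A ->
     distribution P nu A = G A)
  (ln_nu : P.-integrable setT (fun w => (ln (nu w : R))%:E))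
  (delta : R)
  (delta_def : delta = euler_gamma R + fine ('E_P[fun w => ln (nu w : R)]))
  (limsup_F :
     (limf_esup (fun x : R => x%:E * neg_log (distr_fun F x)) (pinfty_nbhs R)
      < (expR (- delta))%:E)%E)
  (liminf_F :
     (limf_einf (fun x : R => x%:E * neg_log (distr_fun F x)) (0 : R)^'+
      > (expR (- delta))%:E)%E)
  (K : R.-pker (measurableTypeR R) ~> (measurableTypeR R))
  (K_MBPPLRE : MBPPLRE_kernel T F G K) :
  ergodic_on T K.
Proof.
have mln : measurable_fun [set: measurableTypeR R] (EFin \o @ln R).
  by apply/measurable_EFinP; exact: measurable_ln.
(* This transports the integrability and the mean of [ln nu] to the law [G]. *)
have GE (f : measurableTypeR R -> \bar R) :
    (\int[G]_v f v = \int[distribution P nu]_v f v)%E.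
  by apply: eq_measure_integral => A mA _; exact: esym (nu_G _ mA).
have int_ln : G.-integrable setT (EFin \o @ln R).
  apply/integrableP; split => //; rewrite GE ge0_integral_distribution//.
    by have /integrableP[] := ln_nu.
  exact: measurableT_comp.
have mean_ln : (\int[G]_v (ln v)%:E = (fine 'E_P[fun w => ln (nu w : R)])%:E)%E.
  rewrite GE integral_distribution// unlock fineK//.
  exact: integrable_fin_num ln_nu.
exact: (mbpplre_ergodic mT T_pos F_T G_pos K_MBPPLRE int_ln mean_ln delta_def
  limsup_F liminf_F).
Qed.
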